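(* For every integer $k \ge 2$ there exists a positive integer $h_{0}(k)$, with $h_{0}(k) = O(8^{k}k^{2})$ (that is, $h_{0}(k) \le C\, 8^{k}k^{2}$ for all $k \ge 2$ with an absolute constant $C$), such that for every integer $h \ge h_{0}(k)$ and for every $\varepsilon > 0$ there exists a set $A \subseteq (\mathbb{Z}^{+})^{k}$ such that $R_{A,h}(n)$ is bounded (as a function of the positive integer $n$) and \[ A(x) \gg x^{\frac{1}{h}-\varepsilon} = x^{\min\{\frac{1}{k},\frac{1}{h}\}-\varepsilon}. \]
   Context: Here $(\mathbb{Z}^{+})^{k} = \{1^{k}, 2^{k}, 3^{k}, \dots\}$ denotes the set of positive perfect $k$-th powers. For a set $A$ of positive integers and an integer $h \ge 2$, $R_{A,h}(n)$ denotes the number of solutions of $a_{1} + a_{2} + \dots + a_{h} = n$ with $a_{1}, \dots, a_{h} \in A$ and $a_{1} < a_{2} < \dots < a_{h}$. The counting function is $A(x) = |\{a \in A : a \le x\}|$. The notation $f(x) \ll g(x)$ means $f(x) = O(g(x))$ as $x \to \infty$, and $f \gg g$ means $g \ll f$; the implied constant in the bound for $A(x)$ may depend on $k, h, \varepsilon$ and $A$. *)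

(* Defs.v *)
From mathcomp Require Import all_boot all_order all_algebra.
From mathcomp Require Import all_classical all_reals all_analysis.

Set Implicit Arguments.
Unset Strict Implicit.
Unset Printing Implicit Defensive.
Import Order.TTheory GRing.Theory Num.Theory numFieldNormedType.Exports.
Local Open Scope classical_set_scope.
Local Open Scope ring_scope.

Definition pos_powers (k : nat) : set nat :=
  [set (m ^ k)%N | m in [set m : nat | (0 < m)%N]].

(* The summands range over 'I_n.+1 only to make the type of tuples finite: a
   summand of n never exceeds n, so no solution is lost. *)
Definition nb_reps (A : set nat) (h n : nat) : nat :=
  #|[pred a : h.-tuple 'I_n.+1 |
      [&& [forall i, (tnth a i : nat) \in A],
          [forall i : 'I_h, forall j : 'I_h,
             (i < j)%N ==> (tnth a i < tnth a j)%N]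
        & (\sum_(i < h) tnth a i)%N == n]]|.

(* The bound on the index only makes the type finite: a%:R <= x already implies
   a <= truncn x. *)
Definition counting_fun (R : realType) (A : set nat) (x : R) : nat :=
  #|[pred a : 'I_(Num.truncn x).+1 |
      ((a : nat) \in A) && ((a : nat)%:R <= x)]|.

(* Lets the notation f =O_ +oo g infer the filter structure of +oo. *)
Canonical pinfty_nbhs_filter_on (R : numFieldType) :=
  FilterType (pinfty_nbhs R) _.

(* Main.v *)
(* Take A = {x_i ^ k}, where x_i is chosen uniformly and independently in
   [N_i, 2 N_i) with N_i about i ^ (h (1 + eps) / k); the growth of A is then
   immediate, up to repetitions.

   Fix n and a set S of j <= h indices.  The probability that the x_i ^ k with
   i in S sum to n is O(prod_(i in S) i ^ -(1 + eps / 2)).  For j < 2 ^ k this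
   holds because x_i is determined by the other summands, so that the
   probability is at most 1 / N_i for each i in S, and h >= k 2 ^ k.  For
   j >= 2 ^ k it follows from Hoelder's inequality for exponential sums and
   Hua's inequality, the sums being taken over the residues of a large modulus,
   so that their moments are numbers of solutions of equations.

   Some i in S is at least a power of n, so the expected number of solutions for
   n is O(n ^ -g) with g > 0, and the probability of t pairwise disjoint
   solutions is O(n ^ -(g t)).  For t large, and if the indices start far enough,
   the sum over all j and n is less than 1.  Without t disjoint solutions a
   bounded set of indices meets every solution, which bounds the number of
   solutions by induction on j.  A compactness argument passes from finitely many
   indices to all of them. *)
Require Import Defs.
From mathcomp Require Import all_boot all_order all_algebra.
From mathcomp Require Import all_classical all_reals all_analysis.
From mathcomp Require Import all_field zify ring lra.

Set Implicit Arguments.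
Unset Strict Implicit.
Unset Printing Implicit Defensive.
Import Order.TTheory GRing.Theory Num.Theory numFieldNormedType.Exports.
Local Open Scope classical_set_scope.
Local Open Scope ring_scope.

(** * Divisors *)

(** A divisor [d] of [a * b] is [gcdn d a] times a divisor of [b]. *)
Lemma size_divisorsM (a b : nat) :
  (0 < a)%N -> (0 < b)%N ->
  (size (divisors (a * b)) <= size (divisors a) * size (divisors b))%N.
Proof.
move=> a0 b0; rewrite -(size_allpairs muln); apply: uniq_leq_size.
  exact: divisors_uniq.
move=> d; rewrite -dvdn_divisors ?muln_gt0 ?a0 // => dab.
have g0 : (0 < gcdn d a)%N by rewrite gcdn_gt0 a0 orbT.
rewrite -(divnK (dvdn_gcdl d a)) mulnC.
apply: allpairs_f; rewrite -dvdn_divisors ?dvdn_gcdr //.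
have cop : coprime (d %/ gcdn d a) (a %/ gcdn d a).
  rewrite /coprime -(eqn_pmul2r g0).
  by rewrite mul1n muln_gcdl !divnK ?dvdn_gcdl ?dvdn_gcdr.
rewrite -(Gauss_dvdr b cop) -(dvdn_pmul2r g0) mulnAC.
by rewrite !divnK ?dvdn_gcdl ?dvdn_gcdr.
Qed.

Lemma size_divisors_pfactor (p a : nat) :
  prime p -> (size (divisors (p ^ a)) <= a.+1)%N.
Proof.
move=> pp; have -> : a.+1 = size [seq (p ^ i)%N | i <- iota 0 a.+1].
  by rewrite size_map size_iota.
apply: uniq_leq_size; first exact: divisors_uniq.
move=> d; rewrite -dvdn_divisors ?expn_gt0 ?prime_gt0 //.
move=> /(dvdn_pfactor _ _ pp) [m ma ->].
by apply/mapP; exists m => //; rewrite mem_iota.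
Qed.

(** Raise [a.+1 <= q * (a %/ q).+1 <= q * 2 ^ (a %/ q)] to the power [q]. *)
Lemma exp_succn_le (q a : nat) : (0 < q)%N -> (a.+1 ^ q <= q ^ q * 2 ^ a)%N.
Proof.
move=> q0; have a1 : (a.+1 <= q * 2 ^ (a %/ q))%N.
  rewrite (leq_trans (n := (q * (a %/ q).+1)%N)) //.
    by rewrite mulnC; apply: ltn_ceil.
  by rewrite leq_pmul2l // ltn_expl.
rewrite (leq_trans (n := ((q * 2 ^ (a %/ q)) ^ q)%N)) ?leq_exp2r //.
by rewrite expnMn leq_pmul2l ?expn_gt0 ?q0 // -expnM leq_exp2l // leq_divM.
Qed.

(* Splitting off the full power p ^ a of the least prime factor costs
   (a + 1) ^ q <= p ^ a, except for the finitely many p < 2 ^ q, where it costs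
   an additional constant factor. *)
Lemma size_divisors_bound (q : nat) : (0 < q)%N -> exists K : nat,
  forall n : nat, (0 < n)%N -> (size (divisors n) ^ q <= K * n)%N.
Proof.
move=> q0; pose Q := (q ^ q)%N.
have Q0 : (0 < Q)%N by rewrite expn_gt0 q0.
(* Fewer than [2 ^ q] primes lie below [2 ^ q], so the power of [Q] is bounded independently of
   [n]. *)
suff H n : (0 < n)%N ->
    (size (divisors n) ^ q <= Q ^ count (fun p => p < 2 ^ q)%N (primes n) * n)%N.
  exists (Q ^ (2 ^ q))%N => n n0; apply: leq_trans (H n n0) _.
  rewrite leq_pmul2r // leq_pexp2l // -size_filter.
  rewrite -{2}(size_iota 0 (2 ^ q)); apply: uniq_leq_size.
    by rewrite filter_uniq // primes_uniq.
  by move=> p; rewrite mem_filter mem_iota => /andP[].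
have [N] := ubnP n; elim: N n => // N IH n nN n0.
have [n1|n1] := leqP n 1.
  by have -> : n = 1%N by [lia]; rewrite exp1n.
pose p := pdiv n; have pp : prime p by exact: pdiv_prime.
have pn : (p %| n)%N by exact: pdiv_dvd.
have [a [m [cpm nE]]] : exists a m, coprime p m /\ n = (m * p ^ a)%N.
  by have [m ? ?] := pfactor_coprime pp n0; exists (logn p n), m.
have m0 : (0 < m)%N by move: n0; rewrite nE muln_gt0 => /andP[].
have a0 : (0 < a)%N.
  case: a nE => // nE; move: pn; rewrite nE muln1 => pm.
  move: cpm; rewrite /coprime (eqP (_ : gcdn p m == p)) //; last first.
    by rewrite -/(_ %| _); apply/eqP/gcdn_idPl.
  by move=> /eqP p1; rewrite p1 in pp.
have mn : (m < n)%N.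
  rewrite nE -{1}(muln1 m) ltn_pmul2l //.
  by rewrite -(expn0 p) ltn_exp2l ?prime_gt1.
have IHm := IH m (leq_trans mn nN) m0.
have pa : (size (divisors (p ^ a)) ^ q <= Q ^ (p < 2 ^ q)%N * p ^ a)%N.
  apply: leq_trans (_ : a.+1 ^ q <= _)%N.
    by rewrite leq_exp2r // size_divisors_pfactor.
  have [pq|pq] := ltnP p (2 ^ q).
    rewrite expn1 (leq_trans (exp_succn_le a q0)) // leq_pmul2l //.
    by rewrite leq_exp2r // prime_gt1.
  rewrite mul1n (leq_trans (n := (2 ^ a) ^ q)%N) //.
    by rewrite leq_exp2r // ltn_expl.
  by rewrite -expnM mulnC expnM leq_exp2r.
have cE : count (fun p => p < 2 ^ q)%N (primes n)
        = (count (fun p => p < 2 ^ q)%N (primes m) + (p < 2 ^ q)%N)%N.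
  have /permP -> : perm_eq (primes n) (primes m ++ [:: p]).
    apply: uniq_perm; rewrite ?primes_uniq //.
      rewrite cat_uniq primes_uniq /= orbF andbT mem_primes.
      by rewrite pp m0 -prime_coprime.
    move=> r; rewrite mem_cat nE primesM ?expn_gt0 ?(prime_gt0 pp) ?m0 //.
    by rewrite primesX // (primes_prime pp).
  by rewrite seq.count_cat /= addn0.
rewrite cE expnD; clearbody p; rewrite nE.
apply: leq_trans (_ : (size (divisors m) * size (divisors (p ^ a))) ^ q <= _)%N.
  by rewrite leq_exp2r // size_divisorsM // expn_gt0 prime_gt0.
by rewrite expnMn mulnACA leq_mul.
Qed.

(** * Iterated differences of integer polynomials *)

Definition pdiff (h : int) (p : {poly int}) : {poly int} :=
  p \Po ('X + h%:P) - p.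

Lemma pdiff_horner (h : int) (p : {poly int}) (x : int) :
  (pdiff h p).[x] = p.[x + h] - p.[x].
Proof. by rewrite /pdiff !hornerE horner_comp !hornerE. Qed.

(** Induction through the recursion [dE] for [p * 'X + c]. For [n = 0] both sides of the second
    claim are [0]. *)
Lemma pdiff_lead (h : int) (n : nat) (p : {poly int}) : (size p <= n.+1)%N ->
  (forall i, (n <= i)%N -> (pdiff h p)`_i = 0) /\
  (pdiff h p)`_n.-1 = n%:R * h * p`_n.
Proof.
elim: n p => [|n IH] p.
  move=> /size1_polyC ->; rewrite /pdiff comp_polyC subrr.
  by split=> [i _|]; rewrite coef0 ?mul0r.
elim/poly_ind: p => [_|p c _ spc].
  by rewrite /pdiff comp_poly0 subrr; split=> [i _|]; rewrite !coef0 ?mulr0.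
have sp : (size p <= n.+1)%N.
  apply/leq_sizeP => j nj; move/leq_sizeP: spc => /(_ j.+1 nj).
  by rewrite coefD coefMX coefC /= addr0.
have [IH1 IH2] := IH p sp.
have dE i : (pdiff h (p * 'X + c%:P))`_i
    = (if i == 0%N then 0 else (pdiff h p)`_i.-1) + h * (pdiff h p)`_i + h * p`_i.
  have -> : pdiff h (p * 'X + c%:P) = pdiff h p * 'X + h *: pdiff h p + h *: p.
    rewrite /pdiff comp_polyD comp_polyM comp_polyX comp_polyC -!mul_polyC.
    by ring.
  by rewrite !(coefD (_ + _), coefD (_ * _)) coefMX !coefZ.
split=> [[//|i] ni|].
  rewrite dE /= IH1 // IH1 1?leqW // mulr0 !add0r.
  by move/leq_sizeP: sp => -> //; rewrite mulr0.
rewrite dE /= (IH1 n) // mulr0 addr0 (coefD (_ * _)) coefMX coefC /= addr0.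
case: n {IH spc} sp IH1 IH2 => [|n] sp IH1 IH2 /=; first by ring.
by rewrite IH2 /= -[n.+2]addn1 natrD; ring.
Qed.

(** The coefficient given by [pdiff_lead] is nonzero in characteristic zero, so the degree drops by
    exactly one. *)
Lemma size_pdiff (h : int) (p : {poly int}) :
  h != 0 -> size (pdiff h p) = (size p).-1.
Proof.
move=> h0; have [sp|sp] := leqP (size p) 1.
  by rewrite (size1_polyC sp) /pdiff comp_polyC subrr size_poly0 size_polyC; case: eqP.
have spE : size p = (size p).-2.+2 by case: (size p) sp => [|[]].
have [d1 d2] := @pdiff_lead h (size p).-1 p ltac:(by rewrite spE).
apply/eqP; rewrite eqn_leq; apply/andP; split; first exact/leq_sizeP.
rewrite leqNgt; apply/negP => sd.
have /leq_sizeP/(_ _ (leqnn _))/eqP : (size (pdiff h p) <= (size p).-2)%N by lia.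
rewrite -[(size p).-2]/((size p).-1.-1)%N d2 !mulf_eq0 (negPf h0) orbF.
rewrite -lead_coefE lead_coef_eq0 -size_poly_eq0 spE.
by rewrite /= pnatr_eq0.
Qed.

(** Over the integers [p - p.[x]] is a multiple of ['X - x], whose value at [x + h] is [h]. *)
Lemma dvdz_horner_sub (p : {poly int}) (x h : int) : (h %| p.[x + h] - p.[x])%Z.
Proof.
have /factor_theorem [q qE] : root (p - p.[x]%:P) x.
  by rewrite /root !hornerE subrr.
have := congr1 (horner^~ (x + h)) qE; rewrite !hornerE => ->.
by rewrite addrAC subrr add0r dvdz_mull.
Qed.

(** Counts the shifts [h_1, ..., h_m] in [[-N, N)] and points [x] in [[0, N)] at which the iterated
    difference of [p] equals [v]. Shifted points may leave [[0, N)], which only enlarges the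
    count. *)
Fixpoint ndiff (N m : nat) (p : {poly int}) (v : int) : nat :=
  if m is m'.+1 then
    (\sum_(i < N.*2) ndiff N m' (pdiff (i%:Z - N%:Z) p) v)%N
  else (\sum_(x < N) (p.[x%:Z] == v))%N.

Lemma nb_roots_le (N : nat) (p : {poly int}) (v : int) :
  p != v%:P -> (\sum_(x < N) (p.[x%:Z] == v) <= size (p - v%:P)%R)%N.
Proof.
move=> pv; rewrite -big_mkcond /= sum1_card cardE.
have := @max_poly_roots _ (p - v%:P)
  [seq (nat_of_ord x)%:Z | x <- enum [pred x : 'I_N | p.[x%:Z] == v]].
rewrite subr_eq0 pv size_map => H; apply/ltnW/H => //.
  apply/allP => y /mapP[x]; rewrite mem_enum inE => px ->.
  by rewrite /root !hornerE subr_eq0.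
by rewrite map_inj_uniq ?enum_uniq // => x y [] /val_inj.
Qed.

Lemma leq_sum_ord (n c : nat) (F : 'I_n -> nat) :
  (forall i, F i <= c)%N -> (\sum_(i < n) F i <= n * c)%N.
Proof.
move=> Fc; apply: leq_trans (leq_sum _ (fun i _ => Fc i)) _.
by rewrite sum_nat_const card_ord.
Qed.

Lemma ndiff_le (N m : nat) (p : {poly int}) (v : int) :
  (ndiff N m p v <= N.*2 ^ m * N)%N.
Proof.
elim: m p => [|m IH] p /=.
  by rewrite mul1n -[leqRHS]muln1; apply: leq_sum_ord => i; case: eqP.
by rewrite expnS -mulnA; apply: leq_sum_ord.
Qed.

(** One of the [m + 1] variables is saved: a nonzero shift lowers the degree by one and is left to
    induction, while the zero shift is a single value. *)
Lemma ndiff_zero (N m d : nat) (p : {poly int}) : (m < size p <= d)%N ->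
  (ndiff N m p 0 <= (d + m) * 2 ^ m * N ^ m)%N.
Proof.
elim: m p => [|m IH] p /andP[mp pd] /=.
  rewrite !muln1 addn0; apply: leq_trans pd; rewrite -{2}(subr0 p).
  by apply: nb_roots_le; rewrite -size_poly_gt0.
case: N IH => [|n] IH; first by rewrite big_ord0.
set N := n.+1 in IH *.
have NN : (N < N.*2)%N by rewrite /N; lia.
(* The index [N] encodes the shift [0]; it gets the trivial bound. *)
rewrite (bigD1 (Ordinal NN)) //= subrr.
apply: leq_trans (_ : N.*2 ^ m * N + N.*2 * ((d + m) * 2 ^ m * N ^ m) <= _)%N.
  rewrite leq_add ?ndiff_le // big_mkcond /=.
  apply: leq_sum_ord => i; case: ifP => // iN; apply: IH.
  rewrite size_pdiff; last first.
    rewrite subr_eq0; apply: contraNneq iN; rewrite -val_eqE /= => -[->]; exact: eqxx.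
  by apply/andP; split; lia.
rewrite -mul2n expnMn !expnS.
have : (0 < 2 ^ m * N ^ m)%N by rewrite muln_gt0 !expn_gt0.
by set a := (2 ^ m)%N; set b := (N ^ m)%N; nia.
Qed.

(** Divisibility of all values by [h] is inherited by every further difference. *)
Lemma ndiff_dvd (N m : nat) (p : {poly int}) (v h : int) :
  (forall x : int, (h %| p.[x])%Z) -> ~~ (h %| v)%Z -> ndiff N m p v = 0%N.
Proof.
move=> hp hv; elim: m p hp => [|m IH] p hp /=.
  rewrite big1 // => x _; case: eqP => // pv; move: hv.
  by rewrite -pv hp.
rewrite big1 // => i _; apply: IH => x.
by rewrite pdiff_horner; apply: rpredB; apply: hp.
Qed.

(* The differencing parameters have to divide v, so each of them takes at most
   2 * D values. *)
Lemma ndiff_nonzero (N m D : nat) (p : {poly int}) (v : int) :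
  v != 0 -> (size (divisors `|v|) <= D)%N -> (m.+1 < size p)%N ->
  (ndiff N m p v <= (2 * D) ^ m * size p)%N.
Proof.
move=> v0 vD; elim: m p => [|m IH] p mp /=.
  rewrite mul1n; have spv : size (p - v%:P) = size p.
    by rewrite size_polyDl // size_polyN (leq_ltn_trans (size_polyC_leq1 _)).
  rewrite -spv; apply: nb_roots_le; rewrite -subr_eq0 -size_poly_gt0 spv.
  exact: leq_trans mp.
have H i : (ndiff N m (pdiff i p) v <= (i %| v)%Z * ((2 * D) ^ m * size p))%N.
  have [iv|iv] := boolP (i %| v)%Z; last first.
    by rewrite (@ndiff_dvd _ _ _ _ i) // => x; rewrite pdiff_horner dvdz_horner_sub.
  rewrite mul1n; have i0 : i != 0 by apply: contraNneq v0 => i0; rewrite i0 dvd0z in iv.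
  apply: leq_trans (IH _ _) _; first by rewrite size_pdiff //; lia.
  by rewrite leq_mul2l size_pdiff // leq_pred orbT.
apply: leq_trans (leq_sum _ (fun i _ => H _)) _.
rewrite -big_distrl /= expnS -mulnA leq_mul2r; apply/orP; right.
(* The admissible shifts are divisors of [v] with either sign, whence the factor [2]. *)
apply: leq_trans (_ : 2 * size (divisors `|v|) <= _)%N; last by rewrite leq_mul2l.
rewrite -big_mkcond /= sum1_card cardE.
rewrite -(size_map (fun i : 'I_N.*2 => (i : nat)%:Z - N%:Z)).
have -> : (2 * size (divisors `|v|) = size ([seq Posz d | d <- divisors `|v|]
     ++ [seq - Posz d | d <- divisors `|v|]))%N.
  by rewrite size_cat !size_map mul2n addnn.
apply: uniq_leq_size.
  rewrite map_inj_uniq ?enum_uniq // => x y /addIr [] xy; exact: val_inj.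
move=> h /mapP[i]; rewrite mem_enum unfold_in => + hE; rewrite -hE mem_cat => hv.
have v0' : (0 < `|v|)%N by rewrite absz_gt0.
have [h0|h0] := leP 0 h.
  apply/orP; left; apply/mapP; exists `|h|%N; last by rewrite gez0_abs.
  by rewrite -dvdn_divisors.
apply/orP; right; apply/mapP; exists `|h|%N; last by rewrite ltz0_abs ?opprK.
by rewrite -dvdn_divisors.
Qed.

(** * Weyl differencing *)

(** Cauchy-Schwarz, from the nonnegativity of the double sum of [(b i - b j) ^+ 2]. *)
Lemma sqr_sum_le (I : finType) (b : I -> algC) : (forall i, 0 <= b i) ->
  (\sum_i b i) ^+ 2 <= #|I|%:R * \sum_i b i ^+ 2.
Proof.
move=> b0; set S := \sum_i b i; set Q := \sum_i b i ^+ 2.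
have bE i : \sum_j (b i - b j) ^+ 2 = #|I|%:R * b i ^+ 2 - b i * (2%:R * S) + Q.
  transitivity (\sum_j (b i ^+ 2 - b i * (2%:R * b j) + b j ^+ 2)).
    by apply: eq_bigr => j _; ring.
  by rewrite !big_split /= sumr_const sumrN -!mulr_sumr -[X in X - _ + _]mulr_natl.
have E : \sum_i \sum_j (b i - b j) ^+ 2 = 2%:R * (#|I|%:R * Q - S ^+ 2).
  under [LHS]eq_bigr do rewrite bE.
  rewrite !big_split /= sumr_const sumrN -mulr_sumr -mulr_suml -/S -/Q -mulr_natl.
  by ring.
have : 0 <= \sum_i \sum_j (b i - b j) ^+ 2.
  apply: sumr_ge0 => i _; apply: sumr_ge0 => j _.
  by rewrite real_exprn_even_ge0 // rpredB // ger0_real.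
by rewrite E pmulr_rge0 ?ltr0Sn // subr_ge0.
Qed.

(** Power mean inequality, by iterating Cauchy-Schwarz. *)
Lemma norm_sum_exp2_le (I : finType) (a : I -> algC) (m : nat) :
  `|\sum_i a i| ^+ (2 ^ m) <= #|I|%:R ^+ (2 ^ m - 1) * \sum_i `|a i| ^+ (2 ^ m).
Proof.
elim: m => [|m IH].
  rewrite !expr1 mul1r; apply: ler_norm_sum.
rewrite expnSr exprM.
apply: le_trans (_ : (#|I|%:R ^+ (2 ^ m - 1) * \sum_i `|a i| ^+ (2 ^ m)) ^+ 2 <= _).
  rewrite ler_pXn2r // nnegrE ?exprn_ge0 // mulr_ge0 ?exprn_ge0 ?ler0n //.
    by apply: sumr_ge0 => i _; rewrite exprn_ge0.
rewrite exprMn -exprM.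
have -> : (2 ^ m * 2 - 1)%N = ((2 ^ m - 1) * 2 + 1)%N.
  by have := expn_gt0 2 m; lia.
rewrite exprD expr1 -mulrA ler_wpM2l ?exprn_ge0 ?ler0n //.
apply: le_trans (sqr_sum_le _) _ => [i|]; first by rewrite exprn_ge0.
rewrite ler_wpM2l ?ler0n //; apply: ler_sum => i _; by rewrite exprM.
Qed.

Definition wsum (N : nat) (w : int -> algC) : algC := \sum_(x < N) w x%:Z.

Definition wdiff (h : int) (w : int -> algC) : int -> algC :=
  fun x => w (x + h) * (w x)^*.

Fixpoint wdsum (N m : nat) (w : int -> algC) : algC :=
  if m is m'.+1 then \sum_(i < N.*2) wdsum N m' (wdiff (i%:Z - N%:Z) w)
  else wsum N w.

(** With weights extended by zero to all integers, Weyl differencing needs no truncated summation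
    ranges. *)
Definition wsupp (N : nat) (w : int -> algC) : Prop :=
  forall x : int, ~~ (0 <= x < N%:Z) -> w x = 0.

Lemma wsupp_diff (N : nat) (h : int) (w : int -> algC) :
  wsupp N w -> wsupp N (wdiff h w).
Proof. by move=> sw x xN; rewrite /wdiff (sw x xN) conjC0 mulr0. Qed.

(** The window [x + [-N, N)] contains [[0, N)], outside of which [w] vanishes. *)
Lemma wsum_shift (N : nat) (w : int -> algC) (x : 'I_N) : wsupp N w ->
  wsum N w = \sum_(i < N.*2) w (x%:Z + (i%:Z - N%:Z)).
Proof.
move=> sw; pose f (z : nat) := w (z%:Z - N%:Z).
have -> : \sum_(i < N.*2) w (x%:Z + (i%:Z - N%:Z)) = \sum_(x <= z < N.*2 + x) f z.
  rewrite (@big_addn _ _ _ 0 (N.*2 + x) x) addnK big_mkord; apply: eq_bigr => i _.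
  by rewrite /f; congr w; lia.
have xN := ltn_ord x.
rewrite (big_cat_nat (n := N)) /=; [|lia..].
rewrite (big_cat_nat (m := N) (n := N.*2)) /=; [|lia..].
have z1 : \sum_(x <= i < N) f i = 0.
  by rewrite big_nat big1 // => i /andP[xi iN]; rewrite /f sw //; lia.
have z2 : \sum_(N.*2 <= i < N.*2 + x) f i = 0.
  by rewrite big_nat big1 // => i /andP[xi iN]; rewrite /f sw //; lia.
rewrite z1 z2 add0r addr0.
rewrite -addnn (@big_addn _ _ _ 0 (N + N) N) addnK big_mkord.
by apply: eq_bigr => i _; rewrite /f; congr w; lia.
Qed.

Lemma sqr_norm_wsum (N : nat) (w : int -> algC) : wsupp N w ->
  `|wsum N w| ^+ 2 = \sum_(i < N.*2) wsum N (wdiff (i%:Z - N%:Z) w).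
Proof.
move=> sw; rewrite normCK {2}/wsum rmorph_sum mulr_sumr exchange_big /=.
apply: eq_bigr => x _; rewrite (wsum_shift x sw) mulr_suml.
by [].
Qed.

(** Square once, apply the power mean inequality to the sum over the [2 N] shifts, and use induction
    on each differenced weight. *)
Lemma weyl (N m : nat) (w : int -> algC) : wsupp N w ->
  `|wsum N w| ^+ (2 ^ m.+1)
    <= N.*2%:R ^+ (2 ^ m.+1 - m.+2) * wdsum N m.+1 w.
Proof.
elim: m w => [|m IH] w sw.
  by rewrite expr0 mul1r sqr_norm_wsum.
rewrite expnS exprM sqr_norm_wsum //.
(* The sum over the shifts equals a squared norm, so a norm may be put around it for
   [norm_sum_exp2_le]. *)
rewrite -(ger0_norm (_ : 0 <= \sum_(i < N.*2) wsum N (wdiff (i%:Z - N%:Z) w))); last first.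
  by rewrite -sqr_norm_wsum // exprn_ge0.
apply: le_trans (norm_sum_exp2_le _ _) _.
have -> : (2 * 2 ^ m.+1 - m.+3)%N = (2 ^ m.+1 - 1 + (2 ^ m.+1 - m.+2))%N.
  by have := ltn_expl m.+1 (ltnSn 1); lia.
rewrite exprD -mulrA card_ord ler_wpM2l ?exprn_ge0 ?ler0n // mulr_sumr.
apply: ler_sum => i _; apply: IH; exact: wsupp_diff.
Qed.

(** * Additive characters of a finite cyclic group *)

(** For a primitive [M]-th root of unity [z] this is an additive character of the integers modulo
    [M], the analogue of [e(a v / M)]. *)
Definition chi (z : algC) (a : nat) (v : int) : algC := (z ^+ a) ^ v.

Section Characters.
Variables (M : nat) (z : algC).
Hypothesis zP : M.-primitive_root z.

Let M0 : (0 < M)%N := prim_order_gt0 zP.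

Let z0 : z != 0.
Proof.
apply/eqP => z0; have := prim_expr_order zP.
by rewrite z0 expr0n gtn_eqF // => /esym/eqP; rewrite oner_eq0.
Qed.

Let normz : `|z| = 1.
Proof.
apply/eqP; rewrite -(@pexpr_eq1 _ _ M) ?normr_ge0 // -normrX.
by rewrite (prim_expr_order zP) normr1.
Qed.

Lemma chiD (a : nat) (u v : int) : chi z a (u + v) = chi z a u * chi z a v.
Proof. by rewrite /chi expfzDr // expf_neq0. Qed.

Lemma chiN (a : nat) (v : int) : chi z a (- v) = (chi z a v)^*.
Proof.
rewrite /chi -exprz_inv; have -> : (z ^+ a)^-1 = (z ^+ a)^*.
  by rewrite invC_norm normrX normz expr1n expr1n invr1 mul1r.
by case: v => n; rewrite /exprz ?rmorphV ?rmorphXn //= unitfE !expf_neq0.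
Qed.

Lemma norm_chi (a : nat) (v : int) : `|chi z a v| = 1.
Proof.
apply/eqP; rewrite -(@pexpr_eq1 _ _ 2) ?normr_ge0 // normCK -chiN -chiD subrr.
by rewrite /chi expr0z.
Qed.

Lemma chi_sum (a : nat) (I : finType) (f : I -> int) :
  chi z a (\sum_i f i) = \prod_i chi z a (f i).
Proof.
by apply: (big_morph (chi z a)) => [u v|]; [exact: chiD | exact: expr0z].
Qed.

(** Orthogonality: a geometric sum of ratio [z ^ v]. The bound on [v] turns divisibility by [M] into
    [v = 0]. *)
Lemma sum_chi (v : int) : (`|v| < M)%N ->
  \sum_(a < M) chi z a v = M%:R * (v == 0)%:R.
Proof.
move=> vM; have [->|v0] := eqVneq v 0.
  rewrite mulr1 (eq_bigr (fun=> 1)) => [|a _]; last exact: expr0z.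
  by rewrite sumr_const card_ord.
have E a : chi z a v = (z ^ v) ^+ a.
  by rewrite /chi !exprnP !exprz_exp mulrC.
under eq_bigr do rewrite E.
have zv1 : z ^ v != 1.
  have H n : (0 < n)%N -> (n < M)%N -> z ^+ n != 1.
    move=> n0 nM; rewrite -(prim_order_dvd zP).
    by apply/negP => /(dvdn_leq n0); rewrite leqNgt nM.
  have v0' : (0 < `|v|)%N by rewrite absz_gt0.
  case: v v0 vM {E} v0' => n v0 vM v0'; first exact: H.
  by rewrite /exprz invr_eq1; apply: H.
apply/eqP; rewrite mulr0 -(mulrI_eq0 _ (_ : GRing.lreg (z ^ v - 1))); last first.
  by apply/lregP; rewrite subr_eq0.
rewrite -subrX1 exprnP exprz_exp mulrC -exprz_exp -exprnP (prim_expr_order zP).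
by rewrite exp1rz subrr.
Qed.

(* The hypothesis on G says that its Fourier coefficients count the values of tau. *)
Lemma sum_wdsum_le (N m V T : nat) (I : finType) (tau : I -> int)
    (G : 'I_M -> algC) (E : pred int) (q : {poly int}) (w : 'I_M -> int -> algC) :
  (forall v : int, (`|v| <= T)%N ->
     \sum_(a < M) chi z a v * G a = M%:R * (\sum_i (v == tau i))%N%:R) ->
  (forall a x, w a x = if E x then chi z a q.[x] else 0) ->
  (forall x : int, E x -> (`|q.[x]| <= V)%N) -> (2 ^ m * V <= T)%N ->
  \sum_(a < M) wdsum N m (w a) * G a <= M%:R * (\sum_i ndiff N m q (tau i))%N%:R.
Proof.
move=> HG; elim: m V E q w => [|m IH] V E q w wE qV VT /=.
  rewrite mul1n in VT.
  rewrite exchange_big /= natr_sum mulr_sumr.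
  under eq_bigr do rewrite mulr_suml.
  rewrite exchange_big /=; apply: ler_sum => x _.
  case Ex : (E x%:Z); last first.
    rewrite big1 ?mulr_ge0 ?ler0n // => a _; by rewrite wE Ex mul0r.
  under eq_bigr do rewrite wE Ex.
  by rewrite HG // (leq_trans _ VT) // qV.
under eq_bigr do rewrite mulr_suml.
rewrite exchange_big /= (exchange_big _ _ _ _ _ (fun i j => ndiff N m _ _)) /=.
rewrite natr_sum mulr_sumr; apply: ler_sum => i _.
(* Differencing restricts the support to the [x] with both [x] and its shift in [E], and at most
   doubles the bound on the values of [q]. *)
apply: (IH (2 * V)%N (fun x => E x && E (x + (i%:Z - N%:Z)))).
- move=> a x; rewrite /wdiff !wE; case: (E x); last by rewrite conjC0 mulr0.
  by case: (E _); rewrite /= ?mul0r // -chiN -chiD pdiff_horner.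
- move=> x /andP[/qV qx /qV qxh]; rewrite pdiff_horner; lia.
- by rewrite mulnA -expnSr.
Qed.

Variables (N : nat) (p : {poly int}).

Definition sigp (r : nat) (u : {ffun 'I_r -> 'I_N}) : int :=
  \sum_(i < r) p.[(u i)%:Z].

Definition fsum (a : nat) : algC := \sum_(x < N) chi z a p.[x%:Z].

Lemma fsumX (a r : nat) : fsum a ^+ r = \sum_u chi z a (@sigp r u).
Proof.
rewrite -[X in _ ^+ X](card_ord r) -prodr_const.
rewrite (bigA_distr_bigA (fun (_ : 'I_r) (x : 'I_N) => chi z a p.[x%:Z])) /=.
by apply: eq_bigr => u _; rewrite chi_sum.
Qed.

Lemma norm_fsumX (a r : nat) :
  `|fsum a| ^+ (2 * r)
  = \sum_(y : {ffun 'I_r -> 'I_N} * {ffun 'I_r -> 'I_N}) chi z a (sigp y.1 - sigp y.2).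
Proof.
rewrite mulnC exprM -normrX normCK fsumX rmorph_sum mulr_suml.
rewrite (eq_bigr _ (fun i _ => mulr_sumr _ _ _ _)) pair_big /=.
by apply: eq_bigr => y _; rewrite chiD chiN.
Qed.

(** Expand the even moment by [norm_fsumX]. As the modulus exceeds every argument of the characters,
    orthogonality counts solutions of equations, not merely of congruences. *)
Lemma sum_chi_norm_fsum (r T : nat) (v : int) :
  (forall y : {ffun 'I_r -> 'I_N} * {ffun 'I_r -> 'I_N},
     (absz (sigp y.1 - sigp y.2)%R <= T)%N) ->
  (`|v| + T < M)%N ->
  \sum_(a < M) chi z a v * `|fsum a| ^+ (2 * r)
  = M%:R * (\sum_(y : {ffun 'I_r -> 'I_N} * {ffun 'I_r -> 'I_N})
      (v == (sigp y.2 - sigp y.1)%R))%N%:R.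
Proof.
move=> yT vT; under eq_bigr do rewrite norm_fsumX mulr_sumr.
rewrite exchange_big /= natr_sum mulr_sumr; apply: eq_bigr => y _.
under eq_bigr do rewrite -chiD.
rewrite sum_chi; last by have := yT y; lia.
by rewrite -[in RHS]subr_eq0 opprB.
Qed.

End Characters.

(** * Hua's inequality *)

(** The arithmetic form of the [2 r]-th moment of the exponential sum, the mean value in Hua's
    inequality. *)
Definition energy (N r : nat) (p : {poly int}) : nat :=
  (\sum_(y : {ffun 'I_r -> 'I_N} * {ffun 'I_r -> 'I_N}) (sigp p y.1 == sigp p y.2))%N.

Lemma absz_sigp_le (N r V : nat) (p : {poly int}) (u : {ffun 'I_r -> 'I_N}) :
  (forall x : 'I_N, `|p.[x%:Z]| <= V)%N -> (`|sigp p u| <= r * V)%N.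
Proof.
move=> pV; rewrite /sigp; apply: leq_trans (_ : \sum_(i < r) `|p.[(u i)%:Z]| <= _)%N.
  elim/big_ind2: _ => // x1 x2 y1 y2 h1 h2; lia.
by apply: leq_sum_ord => i.
Qed.

Lemma absz_sigp_sub_le (N r V : nat) (p : {poly int}) (u w : {ffun 'I_r -> 'I_N}) :
  (forall x : 'I_N, `|p.[x%:Z]| <= V)%N ->
  (absz (sigp p u - sigp p w)%R <= 2 * (r * V))%N.
Proof. by move=> pV; have := absz_sigp_le u pV; have := absz_sigp_le w pV; lia. Qed.

Lemma sum_norm_fsum (M N r V : nat) (z : algC) (p : {poly int}) :
  M.-primitive_root z ->
  (forall x : 'I_N, `|p.[x%:Z]| <= V)%N -> (2 * (r * V) < M)%N ->
  \sum_(a < M) `|fsum z N p a| ^+ (2 * r) = M%:R * (energy N r p)%:R.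
Proof.
move=> zP pV VM.
have H := @sum_chi_norm_fsum M z zP N p r (2 * (r * V)) 0
  (fun y => absz_sigp_sub_le y.1 y.2 pV) VM.
transitivity (\sum_(a < M) chi z a 0 * `|fsum z N p a| ^+ (2 * r)).
  by apply: eq_bigr => a _; rewrite /chi expr0z mul1r.
rewrite H; congr (_ * _%:R); apply: eq_bigr => y _; congr (nat_of_bool _).
by rewrite eq_sym subr_eq0 eq_sym.
Qed.

(** Of the [2 * 2 ^ m.+1] factors in the moment, [2 ^ m.+1] are bounded by Weyl differencing; the
    others stay as a weight whose Fourier coefficients count the values of
    [sigp p y.2 - sigp p y.1]. *)
Lemma energy_step (N m V : nat) (p : {poly int}) :
  (forall x : 'I_N, `|p.[x%:Z]| <= V)%N ->
  (energy N (2 ^ m.+1) p <= N.*2 ^ (2 ^ m.+1 - m.+2) *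
    \sum_(y : {ffun 'I_(2 ^ m) -> 'I_N} * {ffun 'I_(2 ^ m) -> 'I_N})
       ndiff N m.+1 p (sigp p y.2 - sigp p y.1)%R)%N.
Proof.
(* [T] bounds both the iterated differences of [p] and the differences of two values of [sigp];
   orthogonality is exact since [2 * T < M]. *)
move=> pV; pose T := (2 ^ m.+1 * V)%N; pose M := (T * 2 + T).+1.
have [z zP] := C_prim_root_exists (ltn0Sn _ : 0 < M)%N.
pose E : pred int := fun x => 0 <= x < N%:Z.
pose w (a : 'I_M) (x : int) := if E x then chi z a p.[x] else 0.
have fw (a : 'I_M) : fsum z N p a = wsum N (w a).
  by apply: eq_bigr => x _; rewrite /w /E ltz_nat ltn_ord.
have sw (a : 'I_M) : wsupp N (w a) by move=> x xN; rewrite /w /E (negPf xN).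
rewrite -(ler_nat algC) -(@ler_pM2l _ M%:R) ?ltr0n //.
rewrite -(sum_norm_fsum zP pV); last by rewrite /M /T; lia.
rewrite natrM natrX mulrCA.
apply: le_trans (_ : \sum_(a < M) N.*2%:R ^+ (2 ^ m.+1 - m.+2) *
    (wdsum N m.+1 (w a) * `|fsum z N p a| ^+ (2 * 2 ^ m)) <= _).
  apply: ler_sum => a _.
  have -> : (2 * 2 ^ m.+1 = 2 ^ m.+1 + 2 * 2 ^ m)%N by rewrite !expnS; lia.
  rewrite exprD mulrA.
  by rewrite ler_wpM2r ?exprn_ge0 // fw weyl.
rewrite -mulr_sumr ler_wpM2l ?exprn_ge0 ?ler0n //.
apply: (@sum_wdsum_le M z zP N m.+1 V T _ (fun y => sigp p y.2 - sigp p y.1)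
  (fun a : 'I_M => `|fsum z N p a| ^+ (2 * 2 ^ m)) E p w) => //.
- move=> v vT; apply: (@sum_chi_norm_fsum M z zP N p (2 ^ m) T v) => [y|].
    by have := absz_sigp_sub_le y.1 y.2 pV; rewrite /T expnS mulnA.
  by rewrite /M; lia.
- by case=> // x xN; exact: (pV (Ordinal (xN : (x < N)%N))).
Qed.

Lemma energy1 (N : nat) (p : {poly int}) : {in >= 0 &, injective (fun x => p.[x])} ->
  (energy N 1 p <= N)%N.
Proof.
move=> pinj.
rewrite /energy -(pair_big xpredT xpredT (fun u w => nat_of_bool (sigp p u == sigp p w))) /=.
apply: leq_trans (_ : \sum_(u : {ffun 'I_1 -> 'I_N}) 1 <= _)%N; last first.
  by rewrite sum1_card card_ffun !card_ord expn1.
apply: leq_sum => u _; rewrite (bigD1 u) //= eqxx big1 // => w wu.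
case: eqP => //; rewrite /sigp !big_ord1 => puw.
case/eqP: wu; apply/ffunP => i; rewrite ord1; apply/val_inj.
by case: (pinj (u ord0 : nat)%:Z (w ord0 : nat)%:Z isT isT puw).
Qed.

(** Split the pairs in [energy_step]: those with equal sums number [energy N (2 ^ m) p], bounded by
    induction, and each costs [O(N ^ m.+1)]; each of the others costs only divisor factors. Both
    parts have the same order in [N]. The explicit [D] keeps [C] independent of [N] and [p]. *)
Lemma hua (k m : nat) : (m < k)%N -> exists C : nat,
  forall (N D : nat) (p : {poly int}), (0 < N)%N -> (0 < D)%N ->
    size p = k.+1 -> {in >= 0 &, injective (fun x => p.[x])} ->
    (forall x : 'I_N, `|p.[x%:Z]| <= (2 * N) ^ k)%N ->
    (forall v, (0 < v <= (4 * N) ^ k)%N -> (size (divisors v) <= D)%N) ->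
    (energy N (2 ^ m) p <= C * D ^ m * N ^ (2 ^ m.+1 - m.+1))%N.
Proof.
elim: m => [|m IH] mk.
  by exists 1%N => N D p N0 D0 sp pinj _ _; rewrite !mul1n expn1 energy1.
have [C HC] := IH (ltnW mk).
pose e := (2 ^ m.+1 - m.+2)%N.
have me : (m.+1 < 2 ^ m.+1)%N by exact: ltn_expl.
pose K := ((k.+1 + m.+1) * 2 ^ m.+1)%N.
exists (2 ^ e * (C * K + 2 ^ m.+1 * k.+1))%N => N D p N0 D0 sp pinj pV vD.
have HE := HC N D p N0 D0 sp pinj pV vD.
apply: leq_trans (energy_step m pV) _.
set I := ({ffun 'I_(2 ^ m) -> 'I_N} * {ffun 'I_(2 ^ m) -> 'I_N})%type.
have cI : #|{: I}| = (N ^ (2 ^ m.+1))%N.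
  by rewrite card_prod card_ffun !card_ord -expnD addnn -mul2n -expnS.
apply: leq_trans (_ : N.*2 ^ e * (\sum_(y : I)
   ((sigp p y.1 == sigp p y.2) * (K * N ^ m.+1) + (2 * D) ^ m.+1 * k.+1)) <= _)%N.
  rewrite leq_mul2l; apply/orP; right; apply: leq_sum => y _.
  have [->|yy] := eqVneq.
    rewrite subrr mul1n (leq_trans (ndiff_zero _ (d := k.+1) _)) ?leq_addr //.
    by rewrite sp leqnn andbT; lia.
  rewrite mul0n add0n -sp; apply: ndiff_nonzero; rewrite ?sp //.
    by rewrite subr_eq0 eq_sym.
  (* The difference of the sums is at most [2 ^ m.+1 * (2 * N) ^ k], hence at most [(4 * N) ^ k]. *)
  apply: vD; rewrite absz_gt0 subr_eq0 eq_sym yy /=.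
  apply: leq_trans (absz_sigp_sub_le _ _ pV) _.
  rewrite mulnA -expnS (_ : 4 = 2 * 2)%N // -mulnA [X in (_ <= X)%N]expnMn leq_mul2r.
  by rewrite leq_exp2l // (ltnW mk) orbT.
rewrite big_split /= -big_distrl /= sum_nat_const cI -/(energy N (2 ^ m) p).
apply: leq_trans (_ : N.*2 ^ e * (C * D ^ m * N ^ (2 ^ m.+1 - m.+1) * (K * N ^ m.+1)
  + N ^ 2 ^ m.+1 * ((2 * D) ^ m.+1 * k.+1)) <= _)%N.
  by rewrite leq_mul2l leq_add2r leq_mul2r HE !orbT.
have E1 : (N ^ 2 ^ m.+1 = N ^ (2 ^ m.+1 - m.+1) * N ^ m.+1)%N.
  by rewrite -expnD subnK // ltnW.
have E2 : (N ^ (2 ^ m.+2 - m.+2) = N ^ e * (N ^ (2 ^ m.+1 - m.+1) * N ^ m.+1))%N.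
  by rewrite -E1 -expnD; congr expn; rewrite /e expnS; lia.
rewrite E2 E1 -mul2n !expnMn.
set A := (N ^ e)%N; set B := (N ^ (_ - _))%N; set F := (N ^ m.+1)%N.
set b := (2 ^ e)%N; set d := (2 ^ m.+1)%N.
have Dm : (D ^ m <= D ^ m.+1)%N by rewrite leq_pexp2l.
apply: leq_trans (_ : b * A * (B * F) * (C * K * D ^ m + d * k.+1 * D ^ m.+1) <= _)%N.
  by apply/eq_leq; ring.
apply: leq_trans (_ : b * A * (B * F) * (C * K * D ^ m.+1 + d * k.+1 * D ^ m.+1) <= _)%N.
  by rewrite leq_mul2l leq_add2r leq_mul2l Dm !orbT.
by apply/eq_leq; ring.
Qed.

(** The translation lets the range [[0, N)] of the exponential sums stand for the interval
    [[N, 2 N)] of the [x_i]. *)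
Definition kpoly (N k : nat) : {poly int} := ('X + (N%:Z)%:P) ^+ k.

Lemma kpoly_horner (N k x : nat) : (kpoly N k).[x%:Z] = ((N + x) ^ k)%N%:Z.
Proof. by rewrite /kpoly !hornerE -PoszD addnC -!natz natrX. Qed.

Lemma hua_powers (k : nat) : (0 < k)%N -> exists C : nat,
  forall N D : nat, (0 < N)%N -> (0 < D)%N ->
    (forall v, (0 < v <= (4 * N) ^ k)%N -> (size (divisors v) <= D)%N) ->
    (energy N (2 ^ k.-1) (kpoly N k) <= C * D ^ k.-1 * N ^ (2 ^ k - k))%N.
Proof.
move=> k0; have [|C HC] := @hua k k.-1; first by rewrite prednK.
exists C => N D N0 D0 vD.
have := HC N D (kpoly N k); rewrite prednK //; apply=> //.
- by rewrite /kpoly -[(N%:Z)%:P]opprK -polyCN size_exp_XsubC.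
- move=> x y x0 y0; have {}x0 : 0 <= x := x0; have {}y0 : 0 <= y := y0.
  rewrite -(gez0_abs x0) -(gez0_abs y0) /= !kpoly_horner => -[] /eqP.
  by rewrite eqn_exp2r // eqn_add2l => /eqP ->.
- move=> x; rewrite kpoly_horner /= leq_exp2r // mul2n -addnn leq_add2l ltnW //.
Qed.

(** * Random choices of the x_i *)

(** Hoelder's inequality with equal exponents: divide each [F i] by its norm [c i] and apply the
    arithmetic-geometric mean inequality at each [a]. *)
Lemma sum_prod_le_holder (I K : finType) (A : {set I}) (F : I -> K -> algC) :
  (0 < #|A|)%N -> (forall i a, 0 <= F i a) ->
  (\sum_a \prod_(i in A) F i a) ^+ #|A| <= \prod_(i in A) \sum_a F i a ^+ #|A|.
Proof.
move=> j0 F0; set j := #|A|; pose X i := \sum_a F i a ^+ j.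
have X0 i : 0 <= X i by apply: sumr_ge0 => a _; rewrite exprn_ge0.
(* If a norm vanishes, that factor is identically zero, and so is the left side. *)
case: (boolP [exists i in A, X i == 0]) => [/existsP[i /andP[iA /eqP Xi]]|].
  rewrite big1 ?expr0n ?gtn_eqF //; first by apply: prodr_ge0 => l _; exact: X0.
  move=> a _; rewrite (bigD1 i) //=.
  have := psumr_eq0P (fun a _ => exprn_ge0 j (F0 i a)) Xi => /(_ a isT) /eqP.
  by rewrite expf_eq0 => /andP[_ /eqP ->]; rewrite mul0r.
rewrite negb_exists => /forallP Xn0.
pose c i := j.-root (X i).
have cX i : c i ^+ j = X i by rewrite /c rootCK.
have c0 i : i \in A -> 0 < c i.
  move=> iA; rewrite rootC_gt0 // lt_def X0 andbT.
  by have := Xn0 i; rewrite iA.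
have -> : \prod_(i in A) \sum_a F i a ^+ j = (\prod_(i in A) c i) ^+ j.
  by rewrite -prodrXl; apply: eq_bigr => i _; rewrite cX.
rewrite ler_pXn2r ?nnegrE //; last 2 first.
- by apply: sumr_ge0 => a _; apply: prodr_ge0.
- by apply: prodr_ge0 => i /c0/ltW.
have H a : \prod_(i in A) F i a
    <= (\prod_(i in A) c i) * ((\sum_(i in A) (F i a / c i) ^+ j) / j%:R).
  have -> : \prod_(i in A) F i a = \prod_(i in A) c i * \prod_(i in A) (F i a / c i).
    rewrite -big_split /=; apply: eq_bigr => i iA.
    by rewrite mulrC divfK // gt_eqF // c0.
  rewrite ler_wpM2l //; first by apply: prodr_ge0 => i /c0/ltW.
  have F0' i : i \in A -> 0 <= F i a / c i by move=> iA; rewrite divr_ge0 // ltW // c0.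
  have := @leif_rootC_AGM _ _ (mem A) (fun i => (F i a / c i) ^+ j)
    (fun i iA => exprn_ge0 j (F0' i iA)).
  case=> + _; rewrite prodrXl exprCK //; exact: prodr_ge0.
apply: le_trans (ler_sum _ (fun a _ => H a)) _.
rewrite -mulr_sumr -mulr_suml exchange_big /=.
have -> : \sum_(i in A) \sum_a (F i a / c i) ^+ j = j%:R.
  rewrite -sumr_const; apply: eq_bigr => i iA.
  under eq_bigr do rewrite exprMn exprVn.
  by rewrite -mulr_suml -/(X i) cX divff // -cX expf_neq0 // gt_eqF // c0.
by rewrite divff ?mulr1 // pnatr_eq0 -lt0n.
Qed.

Section Sample.
Variables (L B k : nat) (N : nat -> nat).
Hypothesis NB : forall i : 'I_L, (N i <= B)%N.

(** A sample holds the offsets of the [x_i] from [N i]; the common bound [B] makes the sample space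
    a finite type. Probabilities are ratios to [#|sample|]. *)
Definition sample : pred {ffun 'I_L -> 'I_B} :=
  fun om => [forall i, om i < N i]%N.

Definition smpval (om : {ffun 'I_L -> 'I_B}) (i : 'I_L) : nat := ((N i + om i) ^ k)%N.

Lemma sum_sample (F : 'I_L -> 'I_B -> algC) :
  \sum_(om | sample om) \prod_(i < L) F i (om i)
  = \prod_(i < L) \sum_(x : 'I_B | (x < N i)%N) F i x.
Proof.
rewrite (bigA_distr_big_dep (fun (i : 'I_L) (x : 'I_B) => (x < N i)%N) F) /=.
apply: eq_bigl => om; rewrite /sample; apply/forallP/familyP => H i.
  by have := H i.
exact: H i.
Qed.

Lemma sum_sample1 (i : 'I_L) (f : nat -> algC) :
  \sum_(x : 'I_B | (x < N i)%N) f x = \sum_(x < N i) f x.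
Proof. by rewrite (big_ord_widen _ _ (NB i)). Qed.

Lemma card_sample : #|sample|%:R = \prod_(i < L) (N i)%:R :> algC.
Proof.
have := sum_sample (fun _ _ => 1).
rewrite (eq_bigr (fun=> 1)) => [|om _]; last by rewrite big1.
rewrite sumr_const => ->; apply: eq_bigr => i _.
by rewrite (sum_sample1 i (fun=> 1)) sumr_const card_ord.
Qed.

Definition solset (n : nat) (S : {set 'I_L}) : pred {ffun 'I_L -> 'I_B} :=
  fun om => sample om && (\sum_(i in S) smpval om i == n)%N.

(** Detect the equation by characters, apply Hoelder over [S], and bound [#|S| - 2 * r] of the
    factors in each [#|S|]-th moment trivially, leaving an energy. The statement is free of
    divisions and roots. *)
Lemma card_solset_holder (n r : nat) (S : {set 'I_L}) : (0 < r)%N -> (2 * r <= #|S|)%N ->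
  (#|solset n S| ^ #|S| * \prod_(i in S) N i ^ (2 * r)
   <= #|sample| ^ #|S| * \prod_(i in S) energy (N i) r (kpoly (N i) k))%N.
Proof.
move=> r0 rS; have j0 : (0 < #|S|)%N by lia.
pose V := ((2 * B) ^ k)%N.
pose M := (n + L * V + 2 * (r * V)).+1.
have [z zP] := C_prim_root_exists (ltn0Sn _ : 0 < M)%N.
have M0 : (0 : algC) < M%:R by rewrite ltr0n.
have svV om i : sample om -> (smpval om i <= V)%N.
  move=> /forallP /(_ i) oi; rewrite /smpval /V; case: (k) => // k'.
  by rewrite leq_exp2r // mul2n -addnn leq_add // ltnW // (leq_trans oi).
pose f (a : 'I_M) (i : 'I_L) := fsum z (N i) (kpoly (N i) k) a.
have HF : M%:R * #|solset n S|%:R = \sum_(a < M) chi z a (- n%:Z) *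
    \prod_(i < L) (if i \in S then f a i else (N i)%:R).
  transitivity (\sum_(om | sample om) \sum_(a < M)
      chi z a ((\sum_(i in S) smpval om i)%N%:Z - n%:Z)).
    rewrite -sum1_card big_mkcondr /= natr_sum mulr_sumr; apply: eq_bigr => om som.
    rewrite (sum_chi zP).
      by rewrite subr_eq0 eqz_nat; case: eqP.
    have : (\sum_(i in S) smpval om i <= L * V)%N.
      rewrite (leq_trans (n := (\sum_(i in S) V)%N)) //.
        by apply: leq_sum => i _; exact: svV.
      rewrite sum_nat_const leq_mul2r; apply/orP; right.
      by have := max_card (mem S); rewrite card_ord.
    rewrite /M; set s := (\sum_(i in S) _)%N; move: (L * V)%N (r * V)%N s => x y s.
    lia.
  rewrite exchange_big /=; apply: eq_bigr => a _.
  have -> : \prod_(i < L) (if i \in S then f a i else (N i)%:R)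
     = \prod_(i < L) \sum_(x : 'I_B | (x < N i)%N)
         (if i \in S then chi z a ((N i + x) ^ k)%N%:Z else 1).
    apply: eq_bigr => i _.
    rewrite (sum_sample1 i (fun x => if i \in S then chi z a ((N i + x) ^ k)%N%:Z else 1)).
    case: ifP => iS; last by rewrite sumr_const card_ord.
    by apply: eq_bigr => x _; rewrite kpoly_horner.
  rewrite -sum_sample mulr_sumr; apply: eq_bigr => om som.
  rewrite addrC (chiD zP); congr (_ * _).
  rewrite -big_mkcond /=.
  apply: (big_morph (fun m : nat => chi z a m%:Z)) => [u v|]; last exact: expr0z.
  by rewrite PoszD (chiD zP).
have PE (x y : 'I_L -> algC) :
    \prod_(i < L) (if i \in S then x i else y i)
    = \prod_(i in S) x i * \prod_(i < L | i \notin S) y i.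
  rewrite (bigID (mem S)) /=; congr (_ * _); apply: eq_bigr => i iS; first by rewrite iS.
  by rewrite (negPf iS).
(* The coordinates outside [S] are free and contribute only their number of choices. *)
pose P := \prod_(i < L | i \notin S) (N i)%:R : algC.
have P0 : 0 <= P by apply: prodr_ge0 => i _; rewrite ler0n.
have sE : #|sample|%:R = \prod_(i in S) (N i)%:R * P.
  rewrite card_sample -(PE (fun i : 'I_L => (N i)%:R) (fun i => (N i)%:R)).
  by apply: eq_bigr => i _; case: ifP.
have le1 : M%:R * #|solset n S|%:R <= (\sum_(a < M) \prod_(i in S) `|f a i|) * P.
  rewrite -[leLHS]ger0_norm ?mulr_ge0 ?ler0n // HF mulr_suml.
  apply: le_trans (ler_norm_sum _ _ _) _; apply: ler_sum => a _.
  by rewrite normrM (norm_chi zP) mul1r PE -/P normrM normr_prod (ger0_norm P0).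
have le2 (i : 'I_L) : i \in S -> \sum_(a < M) `|f a i| ^+ #|S|
    <= (N i)%:R ^+ (#|S| - 2 * r) * (M%:R * (energy (N i) r (kpoly (N i) k))%:R).
  move=> _; rewrite -(@sum_norm_fsum M (N i) r V z) //; last 2 first.
  - move=> x; rewrite kpoly_horner /= /V; case: (k) => // k'.
    by rewrite leq_exp2r // mul2n -addnn leq_add // ltnW // (leq_trans (ltn_ord x)).
  - by rewrite /M ltnS leq_addl.
  rewrite mulr_sumr; apply: ler_sum => a _.
  rewrite -{1}(subnK rS) exprD ler_wpM2r ?exprn_ge0 //.
  rewrite lerXn2r ?nnegrE ?ler0n // (le_trans (ler_norm_sum _ _ _)) //.
  under eq_bigr do rewrite (norm_chi zP).
  by rewrite sumr_const card_ord.
rewrite -(ler_nat algC) !natrM !natrX !natr_prod.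
rewrite -(@ler_pM2l _ (M%:R ^+ #|S|)) ?exprn_gt0 //.
rewrite mulrA -exprMn.
apply: le_trans (_ : (\prod_(i in S) \sum_(a < M) `|f a i| ^+ #|S|) * P ^+ #|S| *
    \prod_(i in S) (N i ^ (2 * r))%:R <= _).
  rewrite ler_wpM2r ?prodr_ge0 //.
  apply: le_trans (_ : ((\sum_(a < M) \prod_(i in S) `|f a i|) * P) ^+ #|S| <= _).
    rewrite lerXn2r ?nnegrE ?mulr_ge0 ?ler0n //.
    by apply: sumr_ge0 => a _; apply: prodr_ge0.
  rewrite exprMn ler_wpM2r ?exprn_ge0 //.
  exact: (sum_prod_le_holder (F := fun i a => `|f a i|)).
rewrite sE exprMn -[(\prod_(i in S) (N i)%:R) ^+ _]prodrXl; clearbody P.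
apply: le_trans (_ : (\prod_(i in S) ((N i)%:R ^+ (#|S| - 2 * r) *
    (M%:R * (energy (N i) r (kpoly (N i) k))%:R))) * P ^+ #|S| *
    \prod_(i in S) (N i ^ (2 * r))%:R <= _).
  rewrite ler_wpM2r ?prodr_ge0 //.
  rewrite ler_wpM2r ?exprn_ge0 //; apply: ler_prod => i iS.
  by rewrite le2 // andbT; apply: sumr_ge0 => a _; rewrite exprn_ge0.
rewrite mulrAC -big_split /= (eq_bigr (fun i : 'I_L => M%:R *
    ((N i)%:R ^+ #|S| * (energy (N i) r (kpoly (N i) k))%:R))) => [|i iS]; last first.
  by rewrite natrX -[in RHS](subnK rS) exprD; ring.
by rewrite !big_split /= prodr_const le_eqVlt; apply/orP; left; apply/eqP; ring.
Qed.

End Sample.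

(** * Single coordinates and independence *)

Section Independence.
Variables (L B k : nat) (N : nat -> nat).
Hypothesis NB : forall i : 'I_L, (N i <= B)%N.

Notation Om := {ffun 'I_L -> 'I_B}.
Notation samp := (@sample L B N).

(** Overwriting coordinate [i] of a solution by an arbitrary [x] is injective in both: the old
    coordinate is recovered from the others through the equation. *)
Lemma card_solset_single (n : nat) (S : {set 'I_L}) (i : 'I_L) : (0 < k)%N -> i \in S ->
  (#|@solset L B k N n S| * N i <= #|samp|)%N.
Proof.
move=> k0 iS; pose X := [pred x : 'I_B | (x < N i)%N].
have -> : N i = #|X|.
  rewrite -sum1_card -(big_ord_widen B (fun=> 1%N) (NB i)).
  by rewrite sum1_card card_ord.
rewrite -cardX.
pose upd (y : Om * 'I_B) : Om := [ffun j => if j == i then y.2 else y.1 j].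
have updi : {in [predX @solset L B k N n S & X] &, injective upd}.
  move=> [om x] [om' x'] /andP[/= /andP[sm /eqP ss] xN] /andP[/= /andP[sm' /eqP ss'] xN'] E.
  have -> : x = x' by have /ffunP/(_ i) := E; rewrite !ffunE eqxx.
  congr pair; apply/ffunP => j; have [->|ji] := eqVneq j i; last first.
    by have /ffunP/(_ j) := E; rewrite !ffunE (negPf ji).
  apply/val_inj => /=; apply/eqP; rewrite -(eqn_add2l (N i)) -(@eqn_exp2r _ _ k) //.
  move: ss; rewrite -ss' (bigD1 i) //= [RHS](bigD1 i) //=.
  rewrite [X in (_ + X)%N](eq_bigr (fun j => smpval k N om' j)) => [/addIn /eqP //|l /andP[_ li]].
  by have /ffunP/(_ l) := E; rewrite !ffunE (negPf li) /smpval => ->.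
rewrite -(card_in_image updi); apply: subset_leq_card; apply/fintype.subsetP => om'.
move=> /fintype.imageP[[om x] /andP[/= /andP[/forallP sm _] xN] ->].
by apply/forallP => j; rewrite ffunE; case: eqP => [->|_].
Qed.

(* Exchanging the coordinates outside S of two independent samples turns
   (F om) && (G om') into (F om) && (G om). *)
Lemma card_indep (S : {set 'I_L}) (F G : pred Om) :
  (forall om om' : Om, {in S, om =1 om'} -> F om = F om') ->
  (forall om om' : Om, {in ~: S, om =1 om'} -> G om = G om') ->
  (#|[pred om | samp om && (F om && G om)]| * #|samp|
   = #|[pred om | samp om && F om]| * #|[pred om | samp om && G om]|)%N.
Proof.
move=> FS GS; rewrite -!cardX.
pose sw (y : Om * Om) : Om * Om :=
  ([ffun i => if i \in S then y.1 i else y.2 i], [ffun i => if i \in S then y.2 i else y.1 i]).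
have swK : involutive sw.
  move=> [om om']; congr pair; apply/ffunP => i; by rewrite ffunE /= !ffunE; case: (i \in S).
have sws y : samp (sw y).1 && samp (sw y).2 = samp y.1 && samp y.2.
  apply/andP/andP => -[/forallP h1 /forallP h2]; split; apply/forallP => i;
    have := h1 i; have := h2 i; by rewrite /sw /= !ffunE; case: (i \in S).
have F1 y : F (sw y).1 = F y.1 by apply: FS => i iS; rewrite ffunE iS.
have G1 y : G (sw y).1 = G y.2.
  by apply: GS => i; rewrite inE ffunE => /negPf ->.
rewrite -(fintype.card_image (inv_inj swK)
  [predX [pred om | samp om && F om] & [pred om | samp om && G om]]).
apply: eq_card => y; rewrite -{2}(swK y) fintype.mem_image; last exact: inv_inj.
rewrite !inE F1 -(G1 (sw y)) swK (_ : (y.2 \in samp) = samp y.2) //.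
have := sws y.
by case: (samp y.1); case: (samp y.2); case: (samp (sw y).1); case: (samp (sw y).2);
  case: (F y.1); case: (G y.1).
Qed.

(** * Pairwise disjoint solutions *)

Section Disjoint.
Variables (j : nat).

(** [U] accumulates the indices already used; starting from the empty set, this asks for [t]
    pairwise disjoint solutions of size [j]. *)
Fixpoint hasdisj (sol : pred {set 'I_L}) (t : nat) (U : {set 'I_L}) : bool :=
  if t is t'.+1 then
    [exists S : {set 'I_L}, [&& #|S| == j, [disjoint S & U], sol S & hasdisj sol t' (S :|: U)]]
  else true.

(** Choose disjoint solutions greedily; when this stops, every solution meets [U] or the fewer than
    [t] chosen sets. *)
Lemma hasdisj_hit (sol : pred {set 'I_L}) (t : nat) (U : {set 'I_L}) :
  ~~ hasdisj sol t U -> exists U' : {set 'I_L}, (#|U'| <= #|U| + t * j)%N /\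
    forall S : {set 'I_L}, #|S| = j -> sol S -> ~~ [disjoint S & U'].
Proof.
elim: t U => [//|t IH] U /= nU.
have [/existsP[S /and3P[/eqP Sj SU solS]]|H] :=
    boolP [exists S : {set 'I_L}, [&& #|S| == j, [disjoint S & U] & sol S]].
  have /IH [U' [U'c U'h]] : ~~ hasdisj sol t (S :|: U).
    apply: contra nU => h; apply/existsP; exists S; by rewrite Sj eqxx SU solS.
  exists U'; split=> //; apply: leq_trans U'c _.
  apply: leq_trans (leq_add (leq_card_setU S U) (leqnn _)) _.
  by rewrite mulSn -{2}Sj addnA leq_add2r addnC.
exists U; split=> [|S Sj solS]; first by rewrite leq_addr.
apply: contra H => SU; apply/existsP; exists S; by rewrite Sj eqxx SU solS.
Qed.

Definition sol_of (n : nat) (om : Om) : pred {set 'I_L} :=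
  fun S => (\sum_(i in S) smpval k N om i == n)%N.

Lemma sol_of_local (n : nat) (S : {set 'I_L}) (om om' : Om) :
  {in S, om =1 om'} -> sol_of n om S = sol_of n om' S.
Proof.
by move=> E; rewrite /sol_of; congr (_ == _); apply: eq_bigr => i iS; rewrite /smpval E.
Qed.

Lemma hasdisj_local (n t : nat) (U : {set 'I_L}) (om om' : Om) :
  {in ~: U, om =1 om'} -> hasdisj (sol_of n om) t U = hasdisj (sol_of n om') t U.
Proof.
elim: t U => //= t IH U E; apply: eq_existsb => S.
case: (boolP [disjoint S & U]) => SU; last by rewrite !andbF.
congr [&& _, _, _ & _].
  apply: sol_of_local => i iS; apply: E; rewrite inE.
  by rewrite (disjointFr SU iS).
apply: IH => i; rewrite !inE negb_or => /andP[_ iU]; apply: E; by rewrite inE.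
Qed.

(** Union bound over the first set [S], whose event is independent of the remaining ones since those
    involve only coordinates outside [S]. *)
Lemma card_hasdisj (R : realFieldType) (b : {set 'I_L} -> R) (n t : nat) (U : {set 'I_L}) :
  (forall S : {set 'I_L}, 0 <= b S) ->
  (forall S : {set 'I_L}, #|S| = j -> #|@solset L B k N n S|%:R <= b S * #|samp|%:R) ->
  #|[pred om | samp om && hasdisj (sol_of n om) t U]|%:R
  <= (\sum_(S : {set 'I_L} | #|S| == j) b S) ^+ t * #|samp|%:R.
Proof.
move=> b0 Hb; elim: t U => [|t IH] U /=.
  rewrite expr0 mul1r ler_nat subset_leq_card //.
  by apply/fintype.subsetP => om; rewrite inE andbT.
set E := \sum_(_ | _) _.
have E0 : 0 <= E by apply: sumr_ge0.
have [s0|s0] := posnP #|samp|.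
  rewrite s0 mulr0 (_ : #|_| = 0%N) //; apply: eq_card0 => om.
  rewrite inE; apply/negbTE; rewrite negb_and; apply/orP; left.
  by have := card0_eq s0 om; rewrite inE => /negbT.
apply: le_trans (_ : \sum_(S : {set 'I_L} | #|S| == j)
   #|[pred om | samp om && (sol_of n om S &&
      ([disjoint S & U] && hasdisj (sol_of n om) t (S :|: U)))]|%:R <= _).
  rewrite -natr_sum ler_nat -sum1_card.
  under [X in (_ <= X)%N]eq_bigr do rewrite -sum1_card big_mkcond /=.
  rewrite exchange_big /= big_mkcond /=; apply: leq_sum => om _.
  case: ifP => // /andP[som /existsP[S /and4P[Sj SU sS hS]]].
  by rewrite (bigD1 S) //= inE som sS SU hS.
rewrite exprS -mulrA mulr_suml; apply: ler_sum => S /eqP Sj.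
case: (boolP [disjoint S & U]) => SU; last first.
  rewrite (_ : #|_| = 0%N) ?mulr_ge0 ?exprn_ge0 ?ler0n //.
  by apply: eq_card0 => om; rewrite inE !andbF.
rewrite -(@ler_pM2r _ #|samp|%:R) ?ltr0n // -natrM /=.
rewrite (@card_indep S (fun om => sol_of n om S)
  (fun om => hasdisj (sol_of n om) t (S :|: U))); last 2 first.
- by move=> om om'; apply: sol_of_local.
- move=> om om' H; apply: hasdisj_local => i; rewrite !inE negb_or => /andP[iS _].
  by apply: H; rewrite inE.
rewrite natrM [X in _ <= X](_ : _ = (b S * #|samp|%:R) * (E ^+ t * #|samp|%:R)); last by ring.
by apply: ler_pM; rewrite ?ler0n //; exact: Hb.
Qed.

End Disjoint.
End Independence.

(** Each solution meets a set [U] of at most [t * h] indices. Removing a common index [u] leaves a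
    solution of size [j] for [n - v u]; the truncated subtraction is harmless, as [v u] is one of
    the summands of [n]. *)
Lemma card_sols_le (L h t : nat) (v : 'I_L -> nat) :
  (forall j n, (0 < j <= h)%N ->
     ~~ hasdisj j (fun S : {set 'I_L} => \sum_(i in S) v i == n)%N t finset.set0) ->
  forall j n, (j <= h)%N ->
    (#|[pred S : {set 'I_L} | (#|S| == j) && (\sum_(i in S) v i == n)%N]| <= (t * h) ^ j)%N.
Proof.
move=> H; elim=> [|j IH] n jh.
  rewrite expn0 -(card1 (finset.set0 : {set 'I_L})); apply: subset_leq_card.
  by apply/fintype.subsetP => S; rewrite !inE cards_eq0 => /andP[].
have [U [Uc Uh]] := hasdisj_hit (H j.+1 n jh).
rewrite cards0 add0n in Uc.
pose W u := [pred S : {set 'I_L} | (#|S| == j) && (\sum_(i in S) v i == n - v u)%N].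
apply: leq_trans (_ : \sum_(u in U) #|W u| <= _)%N.
  apply: leq_trans (_ : \sum_(u in U) #|[pred S : {set 'I_L} | (u \in S) &&
      ((#|S| == j.+1) && (\sum_(i in S) v i == n)%N)]| <= _)%N.
    rewrite -sum1_card.
    under [X in (_ <= X)%N]eq_bigr do rewrite -sum1_card big_mkcond /=.
    rewrite exchange_big /= big_mkcond /=; apply: leq_sum => S _.
    rewrite inE; case: ifP => // /andP[/eqP Sj Sn].
    have := Uh S Sj Sn; rewrite -setI_eq0 => /finset.set0Pn[u]; rewrite finset.inE => /andP[uS uU].
    by rewrite (bigD1 u) //= inE uS Sj eqxx Sn.
  apply: leq_sum => u uU.
  have inj : {in [pred S : {set 'I_L} | (u \in S) &&
      ((#|S| == j.+1) && (\sum_(i in S) v i == n)%N)] &,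
      injective (fun S : {set 'I_L} => S :\ u)}.
    move=> S S' /andP[uS _] /andP[uS' _] E.
    by rewrite -(finset.setD1K uS) E finset.setD1K.
  rewrite -(card_in_image inj); apply: subset_leq_card; apply/fintype.subsetP => S'.
  move=> /fintype.imageP[S /andP[uS /andP[/eqP Sj /eqP Sn]] ->].
  rewrite inE -Sn (finset.big_setD1 u uS) /= addKn eqxx andbT.
  by move: Sj; rewrite (cardsD1 u) uS add1n => -[->].
apply: leq_trans (_ : \sum_(u in U) (t * h) ^ j <= _)%N.
  by apply: leq_sum => u _; apply: IH; apply: ltnW.
rewrite sum_nat_const expnS leq_mul2r; apply/orP; right.
by apply: leq_trans Uc _; rewrite leq_mul2l jh orbT.
Qed.

(** An elementary symmetric sum is at most the product of the [1 + y i]. *)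
Lemma sum_prod_subset_le (R : realType) (I : finType) (y : I -> R) (j : nat) :
  (forall i, 0 <= y i) ->
  \sum_(S : {set I} | #|S| == j) \prod_(i in S) y i <= expR (\sum_i y i).
Proof.
move=> y0; apply: le_trans (_ : \sum_(S : {set I}) \prod_(i in S) y i <= _).
  rewrite [leRHS](bigID (fun S : {set I} => #|S| == j)) /= lerDl.
  by apply: sumr_ge0 => S _; apply: prodr_ge0.
apply: le_trans (_ : \prod_i (y i + 1) <= _).
  by rewrite bigA_distr /=; apply: ler_sum => S _; rewrite big_mkcond.
rewrite expR_sum; apply: ler_prod => i _.
by rewrite addr_ge0 //= addrC expR_ge1Dx.
Qed.

(** * Existence of a good sample *)

Section Existence.
Variables (R : realType) (L B k h t n0 : nat) (N : nat -> nat) (E : nat -> R).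
Hypothesis k0 : (0 < k)%N.
Hypothesis t0 : (0 < t)%N.
Hypothesis N0 : forall i, (0 < N i)%N.
Hypothesis NB : forall i : 'I_L, (N i <= B)%N.
Hypothesis Nn0 : forall i, (n0 <= N i ^ k)%N.
Hypothesis Hb : forall j n, (0 < j <= h)%N -> (n0 <= n)%N ->
  exists b : {set 'I_L} -> R, [/\ (forall S, 0 <= b S),
    (forall S : {set 'I_L}, #|S| = j ->
       #|@solset L B k N n S|%:R <= b S * #|@sample L B N|%:R)
    & \sum_(S : {set 'I_L} | #|S| == j) b S <= E n].
Hypothesis HE : forall X, h%:R * \sum_(n0 <= n < X) E n ^+ t < 1.

(** The bad events have total probability below [1]. Only [n0 <= n < X] matters: all summands are at
    least [n0], and [X] exceeds every possible sum. *)
Lemma exists_sample : exists2 om : {ffun 'I_L -> 'I_B}, @sample L B N om &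
  forall j n, (0 < j <= h)%N -> ~~ hasdisj j (sol_of k N n om) t finset.set0.
Proof.
set sm := @sample L B N.
pose X := (L * (2 * B) ^ k).+1.
have sm0 : (0 < #|sm|)%N.
  rewrite -(ltr0n algC) card_sample //; apply: prodr_gt0 => i _.
  by rewrite ltr0n.
pose bad (om : {ffun 'I_L -> 'I_B}) := [exists j : 'I_h, [exists n : 'I_X, (n0 <= n)%N &&
   hasdisj j.+1 (sol_of k N n om) t finset.set0]].
have [om som nbad] : exists2 om, sm om & ~~ bad om.
  apply/exists2P; apply: contrapT => /forallNP Hbad.
  have all_bad om : sm om -> bad om.
    by move=> som; apply: contrapT => /negP nb; apply: (Hbad om).
  suff : (#|sm|%:R : R) < #|sm|%:R by rewrite ltxx.
  apply: le_lt_trans (_ : \sum_(j < h) \sum_(n0 <= n < X)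
     #|[pred om | sm om && hasdisj j.+1 (sol_of k N n om) t finset.set0]|%:R < _).
    rewrite (eq_bigr (fun j : 'I_h => (\sum_(n < X) (if (n0 <= n)%N then
       #|[pred om | sm om && hasdisj j.+1 (sol_of k N n om) t finset.set0]| else 0))%N%:R)); last first.
      move=> j _; rewrite natr_sum big_geq_mkord big_mkcond /=.
      by apply: eq_bigr => n _; case: ifP.
    rewrite -natr_sum ler_nat -sum1_card.
    apply: leq_trans (_ : \sum_(om in sm) \sum_(j < h) \sum_(n < X)
       ((n0 <= n)%N && hasdisj j.+1 (sol_of k N n om) t finset.set0) <= _)%N.
      apply: leq_sum => om som; have /existsP[j /existsP[n Hn]] := all_bad om som.
      by rewrite (bigD1 j) //= (bigD1 n) //= Hn.
    rewrite exchange_big /=; apply: leq_sum => j _.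
    rewrite exchange_big /=; apply: leq_sum => n _.
    case: (leqP n0 n) => nn0 /=; last by rewrite big1.
    rewrite -sum1_card big_mkcondr /= leq_eqVlt; apply/orP; left; apply/eqP.
    by apply: eq_bigr => om som; case: (hasdisj _ _ _ _).
  apply: le_lt_trans (_ : (h%:R * \sum_(n0 <= n < X) E n ^+ t) * #|sm|%:R < _); last first.
    by rewrite gtr_pMl ?ltr0n.
  rewrite -mulrA mulr_natl -[X in _ *+ X](card_ord h) -sumr_const.
  apply: ler_sum => j _; rewrite mulr_suml big_nat [leRHS]big_nat; apply: ler_sum => n /andP[nn0 _].
  have [b [b0 bS bE]] := @Hb j.+1 n (ltn_ord j) nn0.
  apply: le_trans (card_hasdisj t finset.set0 b0 bS) _.
  rewrite ler_wpM2r ?ler0n // lerXn2r // nnegrE; first exact: sumr_ge0.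
  by apply: le_trans bE; apply: sumr_ge0.
exists om => // j n /andP[j0 jh]; apply: contra nbad => hd.
have [S [Sj Sn]] : exists S : {set 'I_L}, #|S| = j /\ (\sum_(i in S) smpval k N om i = n)%N.
  case: (t) t0 hd => //= t' _ /existsP[S /and4P[/eqP ? _ /eqP ? _]]; by exists S.
have nX : (n < X)%N.
  rewrite ltnS -Sn; apply: leq_trans (_ : \sum_(i in S) (2 * B) ^ k <= _)%N.
    apply: leq_sum => i _; rewrite /smpval leq_exp2r // mul2n -addnn leq_add // ltnW //.
  rewrite sum_nat_const leq_mul2r; apply/orP; right.
  by have := max_card (mem S); rewrite card_ord.
have jh' : (j.-1 < h)%N by lia.
apply/existsP; exists (Ordinal jh'); apply/existsP; exists (Ordinal nX) => /=.
rewrite prednK // hd andbT -Sn.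
have /card_gt0P[i iS] : (0 < #|S|)%N by rewrite Sj.
rewrite (bigD1 i) //=; apply: leq_trans (Nn0 i) _; apply: leq_trans (leq_addr _ _).
by rewrite /smpval leq_exp2r // leq_addr.
Qed.

End Existence.

(** Build the sequence term by term, keeping the prefix extendable to solutions of every length. *)
Lemma konig (P : nat -> (nat -> nat) -> Prop) (bnd : nat -> nat) :
  (forall L x y, (forall i, (i < L)%N -> x i = y i) -> P L x -> P L y) ->
  (forall L x, P L.+1 x -> P L x) ->
  (forall L, exists x, (forall i, (i < L)%N -> (x i < bnd i)%N) /\ P L x) ->
  exists x, forall L, P L x.
Proof.
move=> Ploc Pmon Pex.
have PmonD L L' x : (L <= L')%N -> P L' x -> P L x.
  by move=> LL; rewrite -(subnK LL); elim: (L' - L)%N => //= d IH /Pmon.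
pose ext (s : seq nat) := forall L, exists x, [/\ forall i, (i < L)%N -> (x i < bnd i)%N,
  P L x & forall i, (i < size s)%N -> x i = nth 0%N s i].
have ext0 : ext [::] by move=> L; have [x [xb xP]] := Pex L; exists x.
have extS s : ext s -> exists c, ext (rcons s c).
  move=> es; apply: contrapT => /forallNP H.
  have /choice [F HF] : forall c, exists L, ~ exists x,
      [/\ forall i, (i < L)%N -> (x i < bnd i)%N,
      P L x & forall i, (i < size (rcons s c))%N -> x i = nth 0%N (rcons s c) i].
    by move=> c; apply/existsNP => /H.
  (* Every candidate [c] is assumed to fail at level [F c]. A solution at a level above all [F c]
     with [c] below the bound contradicts this for its own next term. *)
  have [x [xb xP xs]] := es (maxn (size s).+1 (\max_(c < bnd (size s)) F c))%N.
  have cb := xb (size s) (leq_maxl _ _).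
  have FL : (F (x (size s)) <= maxn (size s).+1 (\max_(c < bnd (size s)) F c))%N.
    by rewrite leq_max (leq_bigmax (Ordinal cb)) orbT.
  apply: (HF (x (size s))); exists x; split.
  - by move=> i iF; apply: xb; apply: leq_trans FL.
  - exact: PmonD xP.
  - move=> i; rewrite size_rcons ltnS nth_rcons; case: ltngtP => // [/xs //|-> _ //].
have /choice [F HF] : forall s, exists c, ext s -> ext (rcons s c).
  move=> s; have [/extS [c Hc]|ns] := pselect (ext s); first by exists c.
  by exists 0%N.
pose S := fix S n := if n is m.+1 then rcons (S m) (F (S m)) else [::].
have Sext n : ext (S n) by elim: n => //= n IH; exact: HF.
have sS n : size (S n) = n by elim: n => //= n IH; rewrite size_rcons IH.
have nS n i : (i < n)%N -> nth 0%N (S n) i = F (S i).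
  elim: n => //= n IH; rewrite ltnS nth_rcons sS; case: ltngtP => // [/IH //|-> //].
exists (fun i => F (S i)) => L; have [x [_ xP xS]] := Sext L L.
apply: Ploc xP => i iL; by rewrite xS ?sS // nS.
Qed.

(** * Real estimates *)

Section RealEstimates.
Variable R : realType.
Implicit Types (e d p : R) (j k m n : nat).

(** A telescoping form of the integral comparison, from [ln (1 - 1 / x) <= - 1 / x] and
    [1 + y <= expR y]. *)
Lemma powR_step e (i : nat) : 0 < e -> (0 < i)%N ->
  i.+1%:R `^ (- (1 + e)) <= ((i%:R : R) `^ (- e) - i.+1%:R `^ (- e)) / e.
Proof.
move=> e0 i0; set x : R := i.+1%:R; have x0 : 0 < x by rewrite ltr0n.
have i0' : 0 < (i%:R : R) by rewrite ltr0n.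
pose u : R := i%:R / x; have u0 : 0 < u by rewrite divr_gt0.
have uE : u = 1 - x^-1.
  apply/(mulIf (lt0r_neq0 x0)); rewrite /u mulrBl mul1r divfK ?mulVf ?gt_eqF //.
  by rewrite /x -natr1 addrK.
have -> : (i%:R : R) = x * u by rewrite /u mulrCA divff ?mulr1 // gt_eqF.
rewrite powRM ?(ltW x0) ?(ltW u0) // opprD addrC powRD; last by rewrite (lt0r_neq0 x0) implybT.
rewrite powR_inv1 ?(ltW x0) //.
rewrite [X in _ <= X](_ : _ = x `^ (- e) * ((u `^ (- e) - 1) / e)); last by ring.
rewrite ler_wpM2l ?powR_ge0 // ler_pdivlMr // lerBrDr.
have lnu : ln u <= - x^-1.
  have u1 : -1 < u - 1 by lra.
  by have := le_ln1Dx u1; rewrite subrKC => /le_trans; apply; rewrite uE addrAC subrr add0r.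
rewrite /powR gt_eqF //; apply: le_trans (expR_ge1Dx _).
rewrite addrC lerD2l mulrC mulNr -mulrN ler_wpM2l ?(ltW e0) // lerNr.
exact: lnu.
Qed.

Lemma sum_powR_le e m X : 0 < e -> (1 < m)%N ->
  \sum_(m <= i < X) (i%:R : R) `^ (- (1 + e)) <= (m.-1%:R : R) `^ (- e) / e.
Proof.
move=> e0 m1; have [Xm|mX] := leqP X m.
  by rewrite big_geq // divr_ge0 ?powR_ge0 // ltW.
suff : \sum_(m <= i < X) (i%:R : R) `^ (- (1 + e))
    <= (m.-1%:R `^ (- e) - X.-1%:R `^ (- e)) / e.
  move=> /le_trans; apply; rewrite ler_wpM2r ?invr_ge0 ?(ltW e0) //.
  by rewrite gerBl powR_ge0.
elim: X mX => // X IH; rewrite ltnS leq_eqVlt => /orP[/eqP <-|mX].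
  have m0 : (0 < m.-1)%N by rewrite -ltnS prednK // ltnW.
  by have := powR_step e0 m0; rewrite big_nat1 prednK // ltnW.
have X0 : (0 < X)%N by exact: leq_ltn_trans mX.
rewrite big_nat_recr /=; last exact: ltnW.
apply: le_trans (lerD (IH mX) (_ : _ <= (X.-1%:R `^ (- e) - X%:R `^ (- e)) / e)) _.
  have X1 : (0 < X.-1)%N by rewrite -ltnS prednK // (ltn_trans m1).
  by have := powR_step e0 X1; rewrite prednK.
by rewrite -mulrDl addrA subrK.
Qed.

Lemma powR_prod (I : finType) (A : {set I}) (y : I -> R) p :
  (forall i, 0 <= y i) -> (\prod_(i in A) y i) `^ p = \prod_(i in A) (y i) `^ p.
Proof.
move=> y0; suff [] : (\prod_(i in A) y i) `^ p = \prod_(i in A) (y i) `^ p /\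
  0 <= \prod_(i in A) y i by [].
elim/big_ind2: _ => [|x1 x2 y1 y2 [E1 p1] [E2 p2]|i _]; rewrite ?powR1 //.
by rewrite powRM // E1 E2 mulr_ge0.
Qed.

Lemma le_prod_root (I : finType) (A : {set I}) (y : I -> R) p j : (0 < j)%N ->
  0 <= p -> (forall i, 0 <= y i) -> p ^+ j <= \prod_(i in A) y i ->
  p <= \prod_(i in A) (y i) `^ (j%:R^-1).
Proof.
move=> j0 p0 y0 H; rewrite -powR_prod //.
have <- : (p ^+ j) `^ (j%:R^-1) = p.
  by rewrite -powR_mulrn // -powRrM divff ?powRr1 // pnatr_eq0 -lt0n.
apply: ge0_ler_powR; rewrite ?invr_ge0 ?ler0n ?nnegrE ?exprn_ge0 //.
exact: prodr_ge0.
Qed.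

(** The divisor factor is absorbed in the power [d] of [N]. [1 <= C] allows replacing a root of [C]
    by [C] later. *)
Lemma hua_powR k d : (0 < k)%N -> 0 < d -> exists2 C : R, 1 <= C &
  forall N, (0 < N)%N ->
  (energy N (2 ^ k.-1) (kpoly N k))%:R / (N%:R : R) ^+ (2 ^ k)
    <= C * (N%:R : R) `^ (- (k%:R - d)).
Proof.
move=> k0 d0; have [C0 HC] := hua_powers k0.
(* Large enough that the exponent [k.-1 * k / q] coming from the divisor bound is at most [d]. *)
pose q := (Num.truncn ((k * k)%:R / d)).+1.
have [K HK] := @size_divisors_bound q (ltn0Sn _).
have q0 : 0 < (q%:R : R) by rewrite ltr0n.
have kq : k.-1%:R / q%:R * k%:R <= d.
  rewrite mulrAC ler_pdivrMr // [d * _]mulrC -ler_pdivrMr //; apply: ltW.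
  apply: le_lt_trans (truncnS_gt _); rewrite ler_pM2r ?invr_gt0 // natrM.
  by rewrite ler_wpM2r ?ler0n // ler_nat leq_pred.
pose K2 : R := ((K * 4 ^ k)%:R) `^ (k.-1%:R / q%:R).
exists (1 + C0%:R * K2) => [|N N1].
  by rewrite lerDl mulr_ge0 ?ler0n // powR_ge0.
have N0 : 0 < (N%:R : R) by rewrite ltr0n.
pose D := (\max_(v < ((4 * N) ^ k).+1) size (divisors v))%N.
have vD v : (0 < v <= (4 * N) ^ k)%N -> (size (divisors v) <= D)%N.
  move=> /andP[_ vN]; have vN' : (v < ((4 * N) ^ k).+1)%N by [].
  exact: (leq_bigmax (F := fun v : 'I_((4 * N) ^ k).+1 => size (divisors v)) (Ordinal vN')).
have D0 : (0 < D)%N.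
  by apply: leq_trans (vD 1%N _); rewrite //= expn_gt0 muln_gt0 N1.
have Dq : (D ^ q <= K * (4 * N) ^ k)%N.
  have [v vE] := @bigop.eq_bigmax _ (fun v : 'I_((4 * N) ^ k).+1 => size (divisors v))
    ltac:(by rewrite card_ord).
  (* The maximum includes [v = 0], where [divisors] evaluates as at [1]. *)
  rewrite -/D in vE; rewrite vE; have [v0|v0] := posnP v.
    apply: leq_trans (_ : K * 1 <= _)%N; first by rewrite v0; apply: (HK 1%N).
    by rewrite leq_mul2l expn_gt0 muln_gt0 N1 orbT.
  by apply: leq_trans (HK v v0) _; rewrite leq_mul2l -ltnS ltn_ord orbT.
have DR : (D%:R : R) ^+ k.-1 <= K2 * N%:R `^ d.
  have -> : (D%:R : R) ^+ k.-1 = (D ^ q)%:R `^ (k.-1%:R / q%:R).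
    rewrite natrX -[X in _ = X `^ _]powR_mulrn ?ler0n // -powRrM mulrCA divff ?gt_eqF // mulr1.
    by rewrite powR_mulrn ?ler0n.
  apply: le_trans (_ : (K * (4 * N) ^ k)%:R `^ (k.-1%:R / q%:R) <= _).
    by apply: ge0_ler_powR; rewrite ?divr_ge0 ?nnegrE ?ler0n ?ler_nat.
  rewrite expnMn mulnA natrM powRM ?ler0n // ler_wpM2l ?powR_ge0 //.
  rewrite natrX -powR_mulrn ?ler0n // -powRrM; apply: ler_powR; first by rewrite ler1n.
  by rewrite mulrC.
have k2 : (k < 2 ^ k)%N by exact: ltn_expl.
have := HC N D N1 D0 vD; rewrite -(ler_nat R) !natrM !natrX => HE.
rewrite ler_pdivrMr ?exprn_gt0 //; apply: le_trans HE _.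
have -> : (N%:R : R) ^+ (2 ^ k) = N%:R ^+ (2 ^ k - k) * N%:R `^ k%:R.
  by rewrite powR_mulrn ?ler0n // -exprD subnK // ltnW.
rewrite -mulrA [X in _ <= X](_ : _ = (1 + C0%:R * K2) *
   (N%:R `^ (- (k%:R - d)) * N%:R `^ k%:R * N%:R ^+ (2 ^ k - k))); last by ring.
rewrite -powRD ?(lt0r_neq0 N0) ?implybT // opprB subrK !mulrA.
rewrite ler_wpM2r ?exprn_ge0 ?ler0n //.
apply: le_trans (_ : C0%:R * (K2 * N%:R `^ d) <= _).
  by rewrite ler_wpM2l ?ler0n.
by rewrite mulrA ler_wpM2r ?powR_ge0 // lerDr ler01.
Qed.

End RealEstimates.

(** * Scales and solution probabilities *)

Section Construction.
Variables (R : realType) (k h : nat) (eps : R).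
Hypothesis k0 : (0 < k)%N.
Hypothesis kh : (k * 2 ^ k <= h)%N.
Hypothesis eps0 : 0 < eps.

Definition expo : R := h%:R * (1 + eps) / k%:R.

Definition scale (m0 i : nat) : nat := (Num.truncn ((i + m0)%:R `^ expo : R)).+1.

Let h0 : (0 < h)%N.
Proof. by apply: leq_trans kh; rewrite muln_gt0 k0 expn_gt0. Qed.

Let kR : 0 < (k%:R : R). Proof. by rewrite ltr0n. Qed.

Let hR : 0 < (h%:R : R). Proof. by rewrite ltr0n. Qed.

Let expo0 : 0 < expo.
Proof. by rewrite /expo !mulr_gt0 ?invr_gt0 // addr_gt0. Qed.

Let expoK : expo * k%:R = h%:R * (1 + eps).
Proof. by rewrite /expo divfK // gt_eqF. Qed.

Lemma scale_ge (m0 i : nat) : (i + m0)%:R `^ expo <= (scale m0 i)%:R :> R.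
Proof. exact/ltW/truncnS_gt. Qed.

Lemma scale_le (m0 i : nat) : (0 < m0)%N ->
  (scale m0 i)%:R <= 2 * (i + m0)%:R `^ expo :> R.
Proof.
move=> m00; have m1 : 1 <= (i + m0)%:R `^ expo :> R.
  rewrite -[X in X <= _](powRr0 (i + m0)%:R); apply: ler_powR; last exact: ltW.
  by rewrite ler1n addn_gt0 m00 orbT.
rewrite /scale -[X in X <= _]natr1 mulr_natl mulr2n lerD //.
by rewrite truncn_le (le_trans ler01).
Qed.

(** The exponent [expo * k = h * (1 + eps)] is at least [1]. *)
Lemma leq_scaleX (m0 i : nat) : (m0 <= scale m0 i ^ k)%N.
Proof.
have [->//|m00] := posnP m0.
rewrite -(ler_nat R) natrX; apply: le_trans (_ : ((i + m0)%:R `^ expo) ^+ k <= _); last first.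
  by rewrite lerXn2r ?nnegrE ?powR_ge0 ?ler0n // scale_ge.
rewrite -powR_mulrn ?powR_ge0 // -powRrM expoK.
apply: le_trans (le1r_powR _ _); first by rewrite ler_nat leq_addl.
  by rewrite ler1n addn_gt0 m00 orbT.
rewrite -[X in X <= _]mulr1; apply: ler_pM => //; first by rewrite ler1n.
by rewrite lerDl ltW.
Qed.

(* With fewer than 2 ^ k summands a single coordinate suffices, because h / k is
   at least 2 ^ k; otherwise Hoelder's and Hua's inequalities apply. *)
Lemma card_solset_le : exists2 C : R, 0 <= C & forall (m0 L B : nat),
  (0 < m0)%N -> (forall i : 'I_L, scale m0 i <= B)%N ->
  forall (n : nat) (S : {set 'I_L}), (0 < #|S| <= h)%N ->
  #|@solset L B k (scale m0) n S|%:R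
  <= (\prod_(i in S) (C * (i + m0)%:R `^ (- (1 + eps / 2)))) * #|@sample L B (scale m0)|%:R.
Proof.
(* Chosen so that [expo * (k - d) = h * (1 + eps / 2)]; taking the [#|S|]-th root then leaves at
   least [1 + eps / 2], as [#|S| <= h]. *)
pose d : R := k%:R * eps / (2 * (1 + eps)).
have e1 : 0 < 1 + eps by rewrite addr_gt0.
have d0 : 0 < d by rewrite divr_gt0 // mulr_gt0.
have [C C1 HC] := hua_powR k0 d0.
have C0 : 0 <= C by exact: le_trans C1.
exists C => // m0 L B m00 NB n S /andP[S0 Sh].
set N := scale m0; set s := #|solset _ _ _ _|; set sm := #|_|.
have N0 i : (0 < N i)%N by [].
have sm0 : (0 < sm)%N.
  rewrite -(ltr0n algC) card_sample //; apply: prodr_gt0 => i _.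
  by rewrite ltr0n.
have smR : 0 < (sm%:R : R) by rewrite ltr0n.
have NR i : 0 < ((N i)%:R : R) by rewrite ltr0n.
have j0 : 0 < (#|S|%:R : R) by rewrite ltr0n.
have jh : (#|S|%:R : R) <= h%:R by rewrite ler_nat.
have mu1 (i : 'I_L) : 1 <= (i + m0)%:R :> R by rewrite ler1n addn_gt0 m00 orbT.
rewrite -ler_pdivrMr //; set p := _ / _.
have p0 : 0 <= p by rewrite divr_ge0 ?ler0n.
have [r0|rS] := ltnP #|S| (2 ^ k).
  apply: le_trans (@le_prod_root R _ S (fun i => (N i)%:R^-1) p #|S| S0 p0 _ _) _.
  - by move=> i; rewrite invr_ge0 ler0n.
  - rewrite -prodr_const; apply: ler_prod => i iS; rewrite p0 /=.
    rewrite ler_pdivrMr // mulrC ler_pdivlMr // -natrM ler_nat.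
    exact: card_solset_single.
  apply: ler_prod => i _; rewrite powR_ge0 /=.
  apply: le_trans (_ : ((i + m0)%:R `^ (- expo)) `^ #|S|%:R^-1 <= _).
    apply: ge0_ler_powR; rewrite ?invr_ge0 ?ler0n ?nnegrE ?powR_ge0 //.
    by rewrite powRN lef_pV2 ?posrE ?powR_gt0 ?ltr0n ?addn_gt0 ?m00 ?orbT // scale_ge.
  rewrite -powRrM -[X in X <= _]mul1r ler_pM ?powR_ge0 //.
  apply: ler_powR => //; rewrite mulNr lerN2 ler_pdivlMr //.
  rewrite /expo ler_pdivlMr // -mulrA mulrC.
  apply: ler_pM; [by rewrite mulr_ge0 ?ler0n | by lra | |].
    by rewrite -natrM ler_nat; apply: leq_trans kh; rewrite mulnC leq_mul2l ltnW ?orbT.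
  by rewrite lerD2l ler_pdivrMr // ler_peMr ?(ltW eps0) // ler1n.
have r2 : (2 * 2 ^ k.-1 = 2 ^ k)%N by rewrite -expnS prednK.
have := @card_solset_holder L B k N NB n (2 ^ k.-1) S (expn_gt0 _ _).
rewrite r2 => /(_ rS); rewrite -(ler_nat R) !natrM !natrX !natr_prod => H.
apply: le_trans (@le_prod_root R _ S (fun i =>
  (energy (N i) (2 ^ k.-1) (kpoly (N i) k))%:R / (N i)%:R ^+ (2 ^ k)) p #|S| S0 p0 _ _) _.
- by move=> i; rewrite divr_ge0 ?exprn_ge0 ?ler0n.
- rewrite big_split /= prodfV /p expr_div_n ler_pdivlMr; last first.
    by apply: prodr_gt0 => i _; rewrite exprn_gt0.
  rewrite mulrAC ler_pdivrMr ?exprn_gt0 // [X in _ <= X]mulrC.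
  by under eq_bigr do rewrite -natrX.
apply: ler_prod => i _; rewrite powR_ge0 /=.
apply: le_trans (_ : (C * (N i)%:R `^ (- (k%:R - d))) `^ #|S|%:R^-1 <= _).
  apply: ge0_ler_powR; rewrite ?invr_ge0 ?ler0n ?nnegrE ?mulr_ge0 ?powR_ge0 //.
  exact: HC.
rewrite powRM ?powR_ge0 // ler_pM ?powR_ge0 //.
  by apply: ler1_powR => //; rewrite invf_le1 // ler1n.
have kd : k%:R - d = k%:R * (1 + eps / 2) / (1 + eps).
  by rewrite /d; field; rewrite ?gt_eqF //.
have kd0 : 0 <= k%:R - d.
  by rewrite kd divr_ge0 // ?mulr_ge0 ?ler0n //; lra.
apply: le_trans (_ : (((i + m0)%:R `^ expo) `^ (- (k%:R - d))) `^ #|S|%:R^-1 <= _).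
  apply: ge0_ler_powR; rewrite ?invr_ge0 ?ler0n ?nnegrE ?powR_ge0 //.
  rewrite !powRN lef_pV2 ?posrE ?powR_gt0 ?ltr0n ?addn_gt0 ?m00 ?orbT //.
  by apply: ge0_ler_powR; rewrite ?nnegrE ?powR_ge0 ?ler0n // scale_ge.
rewrite -!powRrM; apply: ler_powR => //.
rewrite mulNr mulrN lerN2 mulrA ler_pdivlMr //.
apply: le_trans (_ : (1 + eps / 2) * h%:R <= _).
  by rewrite ler_wpM2l // ltW // addr_gt0 // divr_gt0.
rewrite kd /expo le_eqVlt; apply/orP; left; apply/eqP; field.
by rewrite ?gt_eqF.
Qed.

(** Half of the excess [eps / 2] is traded for a power of [n]: the index of the largest summand
    satisfies [n <= h * (2 * scale m0 i) ^ k], so its [i + m0] is at least a power of [n]. The other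
    half keeps the sum over indices convergent. *)
Lemma card_solset_tail : exists C : R, exists C2 : R, [/\ 0 <= C, 0 <= C2 &
  forall (m0 L B : nat), (0 < m0)%N -> (forall i : 'I_L, scale m0 i <= B)%N ->
  forall (n : nat) (S : {set 'I_L}), (0 < n)%N -> (0 < #|S| <= h)%N ->
  #|@solset L B k (scale m0) n S|%:R
  <= (C2 * n%:R `^ (- (eps / 4 / (h%:R * (1 + eps)))) *
      \prod_(i in S) (C * (i + m0)%:R `^ (- (1 + eps / 4)))) *
     #|@sample L B (scale m0)|%:R].
Proof.
have [C C0 HC] := card_solset_le.
pose g : R := eps / 4 / (h%:R * (1 + eps)).
have g0 : 0 < g by rewrite /g !divr_gt0 // mulr_gt0 // addr_gt0.
pose C2 : R := (h%:R * 4 ^+ k) `^ g.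
exists C, C2; split=> //; first exact: powR_ge0.
move=> m0 L B m00 NB n S n0 /andP[S0 Sh].
have mu0 (i : 'I_L) : 0 < (i + m0)%:R :> R by rewrite ltr0n addn_gt0 m00 orbT.
have mu1 (i : 'I_L) : 1 <= (i + m0)%:R :> R by rewrite ler1n addn_gt0 m00 orbT.
have RHS0 : 0 <= (C2 * n%:R `^ (- g) * \prod_(i in S) (C * (i + m0)%:R `^ (- (1 + eps / 4)))).
  rewrite !mulr_ge0 ?powR_ge0 //; apply: prodr_ge0 => i _.
  by rewrite mulr_ge0 ?powR_ge0.
have [s0|/card_gt0P[om /andP[som /eqP omn]]] := posnP #|@solset L B k (scale m0) n S|.
  by rewrite s0 mulr_ge0 ?ler0n.
have [i iS ni] : exists2 i, i \in S & (n <= h * (2 * scale m0 i) ^ k)%N.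
  have /card_gt0P[i0 i0S] := S0.
  have [i iS imax] := @arg_maxnP _ i0 (mem S) (fun i => smpval k (scale m0) om i) i0S.
  exists i => //; rewrite -omn.
  apply: leq_trans (_ : \sum_(l in S) smpval k (scale m0) om i <= _)%N.
    by apply: leq_sum => l /imax.
  rewrite sum_nat_const leq_mul //.
  have /forallP/(_ i) oi := som.
  by rewrite /smpval leq_exp2r // mul2n -addnn leq_add2l ltnW.
have nR : 0 < (n%:R : R) by rewrite ltr0n.
have mui : (i + m0)%:R `^ (- (eps / 4)) <= C2 * n%:R `^ (- g).
  rewrite !powRN ler_pdivlMr ?powR_gt0 // mulrC ler_pdivrMr ?powR_gt0 //.
  have -> : eps / 4 = (expo * k%:R) * g.
    by rewrite expoK /g; field; rewrite ?gt_eqF // addr_gt0.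
  rewrite powRrM -powRM ?powR_ge0 ?mulr_ge0 ?exprn_ge0 ?ler0n //.
  apply: (ge0_ler_powR (ltW g0)); rewrite ?nnegrE ?mulr_ge0 ?exprn_ge0 ?powR_ge0 ?ler0n //.
  apply: le_trans (_ : h%:R * (2 * (scale m0 i)%:R) ^+ k <= _).
    by rewrite -natrM -natrX -natrM ler_nat.
  rewrite powRrM powR_mulrn ?powR_ge0 // -mulrA -exprMn ler_wpM2l ?ler0n //.
  rewrite lerXn2r ?nnegrE ?mulr_ge0 ?powR_ge0 ?ler0n //.
  rewrite (_ : 4 = 2 * 2) -?mulrA ?ler_wpM2l ?scale_le ?ler0n //.
  by rewrite -natrM.
apply: le_trans (HC m0 L B m00 NB n S _) _; first by rewrite S0.
rewrite ler_wpM2r ?ler0n //.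
rewrite (eq_bigr (fun i : 'I_L => (i + m0)%:R `^ (- (eps / 4)) *
    (C * (i + m0)%:R `^ (- (1 + eps / 4))))) => [|l _]; last first.
  rewrite mulrCA -powRD ?(lt0r_neq0 (mu0 l)) ?implybT //; congr (_ * _ `^ _).
  by field.
rewrite big_split /= ler_wpM2r //.
  by apply: prodr_ge0 => l _; rewrite mulr_ge0 ?powR_ge0.
(* Only the factor at [i] is kept; the others are at most [1]. *)
apply: le_trans mui; rewrite (bigD1 i) //= -[X in _ <= X]mulr1 ler_wpM2l ?powR_ge0 //.
apply: prodr_ile1 => l _; rewrite powR_ge0 /= -[X in _ <= X](powRr0 (l + m0)%:R).
by apply: ler_powR => //; rewrite oppr_le0 divr_ge0 // ltW.
Qed.

End Construction.

(** Only the first [L] terms of [x] enter, as [konig] requires. *)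
Definition few_sols (R : realType) (k h : nat) (eps : R) (m0 K L : nat) (x : nat -> nat) : Prop :=
  (forall i, (i < L)%N -> (scale k h eps m0 i <= x i < 2 * scale k h eps m0 i)%N) /\
  forall j n, (j <= h)%N ->
    (#|[pred S : {set 'I_L} | (#|S| == j) && (\sum_(i in S) x i ^ k == n)%N]| <= K ^ j)%N.

Lemma exists_few_sols (R : realType) (k h : nat) (eps : R) :
  (0 < k)%N -> (k * 2 ^ k <= h)%N -> 0 < eps ->
  exists m0 K, (0 < m0)%N /\ forall L, exists x, few_sols k h eps m0 K L x.
Proof.
move=> k0 kh eps0; have [C [C2 [C0 C20 HC]]] := card_solset_tail k0 kh eps0.
have h0 : (0 < h)%N by apply: leq_trans kh; rewrite muln_gt0 k0 expn_gt0.
have hR : 0 < (h%:R : R) by rewrite ltr0n.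
pose e : R := eps / 4; have e0 : 0 < e by rewrite divr_gt0.
pose g : R := e / (h%:R * (1 + eps)).
have g0 : 0 < g by rewrite /g divr_gt0 // mulr_gt0 // addr_gt0.
(* [C / e] bounds the sum over all indices of [C * (i + m0)] to the power [-(1 + e)]. *)
pose C3 : R := C2 * expR (C / e).
have C30 : 0 <= C3 by rewrite mulr_ge0 ?expR_ge0.
(* With [g * t >= 2] the series over [n] is dominated by that of the inverse squares, whose tail
   from [m0] is at most [1 / m0.-1]; [m0] then makes the total less than [1]. *)
pose t := (Num.truncn (2 / g)).+1.
have gt : 2 <= g * t%:R.
  by rewrite mulrC -ler_pdivrMr // ltW // truncnS_gt.
pose m0 := (Num.truncn (h%:R * C3 ^+ t)).+2.
have m0C : h%:R * C3 ^+ t < (m0.-1%:R : R) by rewrite truncnS_gt.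
pose E (n : nat) : R := C3 * n%:R `^ (- g).
exists m0, (t * h)%N; split=> // L.
pose N := scale k h eps m0.
pose B := (\max_(i < L) N i)%N.
have NB : forall i : 'I_L, (N i <= B)%N.
  by move=> i; exact: (leq_bigmax (F := fun i : 'I_L => N i)).
have [|||||om som Hom] := @exists_sample R L B k h t m0 N E k0 _ _ NB _ _ _.
- by [].
- by [].
- by move=> i; exact: leq_scaleX.
- move=> j n /andP[j0 jh] nm0.
  exists (fun S : {set 'I_L} => if #|S| == j then C2 * n%:R `^ (- g) *
    \prod_(i in S) (C * (i + m0)%:R `^ (- (1 + e))) else 0).
  have b0 (S : {set 'I_L}) : 0 <= C2 * n%:R `^ (- g) *
      \prod_(i in S) (C * (i + m0)%:R `^ (- (1 + e))).
    rewrite !mulr_ge0 ?powR_ge0 //; apply: prodr_ge0 => i _.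
    by rewrite mulr_ge0 ?powR_ge0.
  split.
  + by move=> S; case: ifP.
  + move=> S Sj; rewrite Sj eqxx; apply: HC => //; last by rewrite Sj j0.
    exact: leq_trans nm0.
  rewrite (eq_bigr (fun S : {set 'I_L} => C2 * n%:R `^ (- g) *
      \prod_(i in S) (C * (i + m0)%:R `^ (- (1 + e))))) => [|S ->] //.
  rewrite -mulr_sumr /E /C3 mulrAC ler_wpM2r ?powR_ge0 // ler_wpM2l //.
  apply: le_trans (sum_prod_subset_le _ _) _.
    by move=> i; rewrite mulr_ge0 ?powR_ge0.
  rewrite ler_expR -mulr_sumr ler_wpM2l //.
  rewrite -(big_mkord xpredT (fun i => (i + m0)%:R `^ (- (1 + e)))).
  have := @sum_powR_le R e m0 (L + m0) e0 isT.
  rewrite -{1}(add0n m0) big_addn addnK => /le_trans; apply.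
  rewrite -[X in _ <= X]mul1r ler_wpM2r ?invr_ge0 ?(ltW e0) //.
  rewrite -[X in _ <= X](powRr0 (m0.-1%:R)); apply: ler_powR; first by rewrite ler1n.
  by rewrite oppr_le0 ltW.
- move=> X; apply: le_lt_trans (_ : h%:R * C3 ^+ t * (m0.-1%:R)^-1 < _); last first.
    by rewrite ltr_pdivrMr ?mul1r // ltr0n.
  rewrite -mulrA ler_wpM2l ?ler0n //.
  apply: le_trans (_ : C3 ^+ t * \sum_(m0 <= n < X) (n%:R : R) `^ (- (1 + 1)) <= _).
    rewrite mulr_sumr big_nat [X in _ <= X]big_nat; apply: ler_sum => n /andP[m0n _].
    rewrite /E exprMn ler_wpM2l ?exprn_ge0 // -powR_mulrn ?powR_ge0 // -powRrM.
    apply: ler_powR; first by rewrite ler1n (leq_trans _ m0n).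
    by rewrite mulNr lerN2; apply: le_trans gt; rewrite -mulr2n.
  rewrite ler_wpM2l ?exprn_ge0 //.
  apply: le_trans (sum_powR_le _ _ _) _ => //.
  by rewrite divr1 powR_inv1 ?ler0n.
pose x (i : nat) : nat := if insub i is Some i' then (N i + om i')%N else 0%N.
have xE (i : 'I_L) : x i = (N i + om i)%N by rewrite /x valK.
exists x; split.
  move=> i iL; have := xE (Ordinal iL) => /= ->.
  have /forallP/(_ (Ordinal iL)) := som; rewrite /= leq_addr /= => oi.
  by rewrite mul2n -addnn ltn_add2l.
move=> j n jh; have := @card_sols_le L h t (smpval k N om) Hom j n jh.
rewrite (eq_card (B := [pred S : {set 'I_L} | (#|S| == j) && (\sum_(i in S) x i ^ k == n)%N])) //.
move=> S; rewrite !inE; congr (_ && (_ == _)).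
by apply: eq_bigr => i _; rewrite xE.
Qed.

Lemma exists_seq (R : realType) (k h : nat) (eps : R) :
  (0 < k)%N -> (k * 2 ^ k <= h)%N -> 0 < eps ->
  exists m0 K x, (0 < m0)%N /\ forall L, few_sols k h eps m0 K L x.
Proof.
move=> k0 kh eps0; have [m0 [K [m00 H]]] := exists_few_sols k0 kh eps0.
have [|||x Hx] := @konig (few_sols k h eps m0 K) (fun i => 2 * scale k h eps m0 i)%N; last first.
- by exists m0, K, x.
- move=> L; have [x Hx] := H L; exists x; split=> // i iL.
  by have [/(_ i iL)/andP[]] := Hx.
- move=> L x [xs xK]; split=> [i iL|j n jh]; first by apply: xs; exact: ltnW.
  apply: leq_trans (xK j n jh).
  (* Index sets below [L] embed into those below [L.+1] with the same sums. *)
  pose f (S : {set 'I_L}) : {set 'I_L.+1} := (widen_ord (leqnSn L) @: S)%SET.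
  have winj : injective (widen_ord (leqnSn L)) by move=> a b [] /val_inj.
  have finj : injective f by exact: imset_inj.
  rewrite -(fintype.card_image finj); apply: subset_leq_card.
  apply/fintype.subsetP => S' /fintype.imageP[S /andP[Sj /eqP Sn] ->].
  rewrite inE card_imset // Sj /= -Sn; apply/eqP.
  by rewrite big_imset //= => a b _ _; apply: winj.
- move=> L x y xy [xs xK]; split=> [i iL|j n jh]; first by rewrite -xy // xs.
  rewrite -(eq_card (A := [pred S : {set 'I_L} | (#|S| == j) && (\sum_(i in S) x i ^ k == n)%N])).
    exact: xK.
  by move=> S; rewrite !inE; congr (_ && (_ == _)); apply: eq_bigr => i _; rewrite xy.
Qed.

(** * Representations and growth of the set of values *)

(** Choosing one index for each value maps a representation to a set of [h] indices, since its
    entries are distinct. The map is injective: a strictly increasing tuple is determined by its set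
    of values. *)
Lemma nb_reps_le (K h k : nat) (x : nat -> nat) :
  (forall L n, (#|[pred S : {set 'I_L} | (#|S| == h) && (\sum_(i in S) x i ^ k == n)%N]| <= K)%N) ->
  forall n, (nb_reps [set (x i ^ k)%N | i in [set: nat]] h n <= K)%N.
Proof.
move=> HK n; set A := (X in nb_reps X).
have /choice [g gP] : forall y : nat, exists i, y \in A -> (x i ^ k)%N = y.
  move=> y; have [/set_mem [i _ iy]|yA] := boolP (y \in A); last by exists 0%N.
  by exists i.
pose L := (\max_(y < n.+1) g y)%N.
have gL (y : 'I_n.+1) : (g y < L.+1)%N.
  exact: (leq_bigmax (F := fun y : 'I_n.+1 => g y)).
pose f (a : h.-tuple 'I_n.+1) (q : 'I_h) : 'I_L.+1 := inord (g (tnth a q)).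
pose F (a : h.-tuple 'I_n.+1) : {set 'I_L.+1} := (f a @: finset.setT)%SET.
rewrite /nb_reps; set P := (X in #|X|).
have Pf a : P a -> forall q, (x (f a q) ^ k)%N = tnth a q.
  move=> /and3P[/forallP aA _ _] q; rewrite /f inordK ?gL //.
  by apply: gP; exact: aA.
have Pinc a : P a -> forall i j : 'I_h, (i < j)%N -> (tnth a i < tnth a j)%N.
  move=> /and3P[_ /forallP ai _] i j; have /forallP/(_ j)/implyP := ai i; exact.
have finj a : P a -> injective (f a).
  move=> Pa i j fij; apply: contrapT => /eqP; rewrite neq_ltn => /orP[] /(Pinc a Pa);
  by rewrite -!(Pf a Pa) fij ltnn.
have Fmem a y : P a -> (y \in map val a) = [exists i in F a, (x i ^ k)%N == y].
  move=> Pa; apply/mapP/exists_inP => [[z /tnthP[q ->] ->]|[i /imsetP[q _ ->] /eqP <-]].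
    by exists (f a q); rewrite ?imset_f // Pf.
  by exists (tnth a q); rewrite ?mem_tnth // Pf.
have asort a : P a -> sorted ltn (map val a).
  move=> Pa; apply: pairwise_sorted; apply/(pairwiseP 0%N) => i j.
  rewrite !inE size_map size_tuple => ih jh ij.
  have z0 : 'I_n.+1 := ord0.
  rewrite !(nth_map z0) ?size_tuple //.
  have := Pinc a Pa (Ordinal ih) (Ordinal jh) ij.
  by rewrite !(tnth_nth z0).
have Finj : {in P &, injective F}.
  move=> a b Pa Pb Fab; apply/val_inj/(inj_map val_inj).
  apply: (irr_sorted_eq ltn_trans ltnn (asort a Pa) (asort b Pb)) => y.
  by rewrite !Fmem // Fab.
rewrite -(card_in_image Finj); apply: leq_trans (HK L.+1 n); apply: subset_leq_card.
apply/fintype.subsetP => S /fintype.imageP[a Pa ->]; rewrite inE.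
rewrite card_imset ?cardsT ?card_ord ?eqxx /=; last exact: finj.
rewrite big_imset /=; last by move=> i j _ _; exact: finj.
have /and3P[_ _ /eqP <-] := Pa; apply/eqP; apply: eq_big => [q|q _]; first by rewrite finset.inE.
exact: Pf.
Qed.

(** The bound for singletons says that each value is taken by at most [K] indices, so repetitions
    cost only a factor [K]. *)
Lemma leq_counting_fun (R : realType) (K k M : nat) (x : nat -> nat) (X : R) :
  (forall n, (#|[pred S : {set 'I_M} | (#|S| == 1)%N && (\sum_(i in S) x i ^ k == n)%N]| <= K)%N) ->
  (forall i, (i < M)%N -> ((x i ^ k)%:R <= X)) ->
  (M <= K * counting_fun [set (x i ^ k)%N | i in [set: nat]] X)%N.
Proof.
move=> HK xX; rewrite /counting_fun; set P := (X in #|X|).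
have X0 (i : 'I_M) : 0 <= X by apply: le_trans (xX i (ltn_ord i)); rewrite ler0n.
have fX (i : 'I_M) : (x i ^ k < (Num.truncn X).+1)%N.
  by rewrite ltnS truncn_ge_nat ?xX // (X0 i).
pose f (i : 'I_M) : 'I_(Num.truncn X).+1 := Ordinal (fX i).
have fP i : f i \in P.
  rewrite inE /= xX ?ltn_ord // andbT; apply/mem_set; by exists i.
rewrite -[leqLHS]card_ord -sum1_card (partition_big f P (fun i _ => fP i)) /=.
rewrite mulnC -sum_nat_const; apply: leq_sum => y _; rewrite sum1_card.
apply: leq_trans (HK y).
rewrite -(fintype.card_image (@set1_inj 'I_M)); apply: subset_leq_card.
apply/fintype.subsetP => S /fintype.imageP[i /eqP iy ->].
by rewrite inE cards1 eqxx finset.big_set1 -iy /= eqxx.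
Qed.

(** Every index with [i + m0 <= Y] has [x i ^ k <= X], where [Y] is [c] times the power [th] of [X],
    and [th >= 1 / h - eps]. *)
Lemma bigO_counting_fun (R : realType) (k h m0 K : nat) (eps : R) (x : nat -> nat) :
  (0 < k)%N -> (k * 2 ^ k <= h)%N -> (0 < m0)%N -> 0 < eps ->
  (forall L, few_sols k h eps m0 K L x) ->
  (fun X : R => X `^ (h%:R^-1 - eps))
    =O_ +oo (fun X : R => (counting_fun [set (x i ^ k)%N | i in [set: nat]] X)%:R : R).
Proof.
move=> k0 kh m00 eps0 Hx.
have h0 : (0 < h)%N by apply: leq_trans kh; rewrite muln_gt0 k0 expn_gt0.
have hR : 0 < (h%:R : R) by rewrite ltr0n.
have kR : 0 < (k%:R : R) by rewrite ltr0n.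
have e1 : 0 < 1 + eps by rewrite addr_gt0.
pose be := expo k h eps.
have be0 : 0 < be by rewrite /be /expo !mulr_gt0 ?invr_gt0.
pose th : R := (h%:R * (1 + eps))^-1.
have th0 : 0 < th by rewrite invr_gt0 mulr_gt0.
have thE : th = k%:R^-1 / be by rewrite /th /be /expo; field; rewrite ?gt_eqF.
(* [c] compensates for the factor [4] in [x i <= 4 * (i + m0) ^ be]; [X0] ensures [Y >= 2 * m0.+1],
   so that [M >= Y / 2]. *)
pose c : R := 4 `^ (- be^-1); have c0 : 0 < c by rewrite powR_gt0.
pose X0 : R := (2 * m0.+1%:R / c) `^ th^-1.
apply/eqO_exP; exists (1 + 2 * K%:R / c).
  by rewrite ltr_pwDl // divr_ge0 ?mulr_ge0 ?ler0n ?(ltW c0).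
exists (1 + X0); split; first exact: num_real.
move=> X XX0.
have X01 : 0 <= X0 by exact: powR_ge0.
have X1 : 1 < X by apply: le_lt_trans XX0; rewrite lerDl.
have Xp : 0 < X by apply: lt_trans X1.
rewrite ger0_norm ?powR_ge0 // ger0_norm ?ler0n //.
apply: le_trans (_ : X `^ th <= _).
  apply: ler_powR; first exact: ltW.
  have he1 : 1 <= h%:R * (1 + eps).
    by apply: mulr_ege1; rewrite ?ler1n // lerDl ltW.
  have he0 : 0 < h%:R * (1 + eps) by rewrite mulr_gt0.
  rewrite lerBlDr /th -(ler_pM2r he0) mulKf ?gt_eqF // mulrDl mulVf ?gt_eqF //.
  by rewrite lerD2l ler_peMr // ltW.
pose Y := c * X `^ th.
have Y2 : 2 * m0.+1%:R <= Y.
  rewrite /Y [c * _]mulrC -ler_pdivrMr //.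
  apply: le_trans (_ : X0 `^ th <= _).
    rewrite /X0 -powRrM (mulVf (lt0r_neq0 th0)) powRr1 //.
    by rewrite divr_ge0 ?mulr_ge0 ?ler0n ?(ltW c0).
  apply: ge0_ler_powR; rewrite ?nnegrE ?(ltW th0) ?(ltW Xp) //.
  by apply: ltW; apply: lt_trans XX0; rewrite ltrDr.
pose M := Num.truncn (Y - m0%:R).
have Ym0 : 0 <= Y - m0%:R.
  rewrite subr_ge0; apply: le_trans Y2.
  by rewrite -natrM ler_nat (leq_trans (leqnSn _)) // leq_pmull.
have MY : (M%:R : R) <= Y - m0%:R by rewrite truncn_le.
have YM : Y / 2 <= M%:R.
  have := truncnS_gt (Y - m0%:R); rewrite -/M -(natr1 M).
  by move: Y2; rewrite -(natr1 m0) ler_pdivrMr //; lra.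
have HM : (M <= K * counting_fun [set (x i ^ k)%N | i in [set: nat]] X)%N.
  apply: leq_counting_fun => [n|i iM].
    by have [_ /(_ 1%N n h0)] := Hx M; rewrite expn1.
  have [/(_ i iM)/andP[_ xi] _] := Hx M.
  rewrite natrX; apply: le_trans (_ : (4 * Y `^ be) ^+ k <= _).
    rewrite lerXn2r ?nnegrE ?mulr_ge0 ?powR_ge0 ?ler0n //.
    apply: le_trans (_ : (2 * scale k h eps m0 i)%:R <= _); first by rewrite ler_nat ltnW.
    rewrite natrM [X in _ <= X](_ : _ = 2 * (2 * Y `^ be)); last by ring.
    rewrite ler_wpM2l ?ler0n //.
    apply: le_trans (scale_le k0 kh eps0 i m00) _.
    rewrite ler_wpM2l ?ler0n //; apply: (ge0_ler_powR (ltW be0)); rewrite ?nnegrE ?ler0n //.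
      by apply: le_trans Y2; rewrite mulr_ge0 ?ler0n.
    apply: le_trans (_ : M%:R + m0%:R <= _); last by rewrite -lerBrDr.
    by rewrite -natrD ler_nat leq_add2r ltnW.
  have -> : 4 * Y `^ be = X `^ k%:R^-1.
    rewrite /Y powRM ?(ltW c0) ?powR_ge0 // /c -!powRrM mulNr mulVf ?gt_eqF //.
    by rewrite powR_inv1 ?ler0n // mulrA divff ?mul1r // thE divfK // gt_eqF.
  by rewrite -powR_mulrn ?powR_ge0 // -powRrM mulVf ?gt_eqF // powRr1 // ltW.
have -> : X `^ th = Y / c by rewrite /Y mulrC mulKf // gt_eqF.
apply: le_trans (_ : 2 * K%:R / c *
  (counting_fun [set (x i ^ k)%N | i in [set: nat]] X)%:R <= _); last first.
  by rewrite ler_wpM2r ?ler0n // lerDr ler01.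
rewrite [X in _ <= X]mulrAC ler_pM2r ?invr_gt0 // -[X in _ <= X]mulrA.
rewrite -ler_pdivrMl // [X in X <= _]mulrC.
by apply: le_trans YM _; rewrite -natrM ler_nat.
Qed.

Theorem theorem3 (R : realType) :
  exists (C : R) (h0 : nat -> nat),
    (forall k : nat, (2 <= k)%N ->
       (0 < h0 k)%N /\ (h0 k)%:R <= C * (8 ^+ k * k%:R ^+ 2)) /\
    (forall k h : nat, (2 <= k)%N -> (h0 k <= h)%N ->
     forall eps : R, 0 < eps ->
     exists A : set nat,
       [/\ A `<=` pos_powers k,
           exists B : nat, forall n : nat, (0 < n)%N -> (nb_reps A h n <= B)%N,
           (fun x : R => x `^ (h%:R^-1 - eps))
             =O_ +oo (fun x : R => (counting_fun A x)%:R : R)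
         & forall x : R, 0 < x ->
             x `^ (h%:R^-1 - eps)
             = x `^ (Num.min (k%:R^-1) (h%:R^-1) - eps)]).
Proof.
(* [k * 2 ^ k] is what the case of few summands in [card_solset_le] requires; it is well below
   [8 ^ k * k ^ 2]. *)
exists 1, (fun k => k * 2 ^ k)%N; split=> [k k2|k h k2 kh eps eps0].
  have k0 : (0 < k)%N by exact: ltnW.
  rewrite muln_gt0 k0 expn_gt0; split=> //.
  rewrite mul1r -!natrX -natrM ler_nat mulnC leq_mul //.
    by rewrite leq_exp2r.
  by rewrite expnS expn1 leq_pmulr.
have k0 : (0 < k)%N by exact: ltnW.
have [m0 [K [x [m00 Hx]]]] := exists_seq k0 kh eps0.
have hk : (h%:R^-1 : R) <= k%:R^-1.
  have kh' : (k <= h)%N by apply: leq_trans kh; rewrite leq_pmulr // expn_gt0.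
  by rewrite lef_pV2 ?posrE ?ltr0n ?ler_nat // (leq_trans k0).
exists [set (x i ^ k)%N | i in [set: nat]]; split.
- move=> _ [i _ <-]; exists (x i) => //=.
  by have [/(_ i (ltnSn i))/andP[xi _] _] := Hx i.+1; exact: leq_trans xi.
- exists (K ^ h)%N => n _; apply: nb_reps_le => L l.
  by have [_ /(_ h l (leqnn h))] := Hx L.
- exact: bigO_counting_fun Hx.
- by move=> t _; rewrite min_r.
Qed.
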